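(* Let $p\in\mathbb N$ and $\alpha_1,\dots,\alpha_p,\beta>-1$ with $\alpha_i-\alpha_j\notin\mathbb Z$ for $i\ne j$ in $\{1,\dots,p\}$; extend the notation by $\alpha_{rp+s}:=\alpha_s+r$ for $r\in\mathbb N_0$, $s\in\{1,\dots,p\}$. Let $B_n$ and $A^{(i)}_n$ ($i=1,\dots,p$) be the step line Jacobi--Piñeiro polynomials of type II (monic) and type I defined in the context. Then $$xB_n(x)=B_{n+1}(x)+b^0_nB_n(x)+\sum_{j=1}^pb^j_nB_{n-j}(x)\quad(n\ge0),$$ $$xA^{(i)}_n(x)=A^{(i)}_{n-1}(x)+b^0_{n-1}A^{(i)}_n(x)+\sum_{j=1}^pb^j_{n+j-1}A^{(i)}_{n+j}(x)\quad(n\ge1,\ i\in\{1,\dots,p\}),$$ with the convention $B_r=0$ for $r<0$, where for $j\in\{0,1,\dots,p\}$, $m\ge0$ and $k\in\{0,\dots,p-1\}$, $$b^j_{pm+k}=\frac{\alpha_{k+1}+\beta+(p+1)m+k+1-j}{\prod_{q=p+k+2-j}^{p+k+1}(\alpha_q+\beta+(p+1)m+k-j)}\cdot\frac{(\beta+pm+k+1-j)_j\prod_{q=1}^p(\alpha_q+\beta+pm+k+1-j)_j}{\prod_{q=k+1}^{p+k}(\alpha_q+\beta+(p+1)m+k+1-j)_j}\sum_{i=k+1}^{p+k+1-j}\frac{\alpha_i+m}{(\alpha_i+\beta+(p+1)m+k-j)_{j+2}}\cdot\frac{\prod_{q=1}^p(\alpha_i-\alpha_q+m)}{\prod_{q=k+1,\,q\ne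 i}^{p+k+1-j}(\alpha_i-\alpha_q)} .$$ (Where a denominator involving $\beta$ vanishes, the expression is understood by continuous extension in $(\alpha_1,\dots,\alpha_p,\beta)$.)
   Context: $\mathbb N_0=\{0,1,2,\dots\}$; $|\vec n|=n_1+\cdots+n_p$; $(x)_0=1$, $(x)_n=x(x+1)\cdots(x+n-1)$; empty products equal $1$ and empty sums equal $0$. The Jacobi--Piñeiro polynomials are the multiple orthogonal polynomials for the weights $x^{\alpha_i}$, $i=1,\dots,p$, with respect to $(1-x)^\beta dx$ on $[0,1]$. For $\vec n=(n_1,\dots,n_p)\in\mathbb N_0^p$: Type II (monic, degree $|\vec n|$): with $\lambda_r=l_r+\cdots+l_p$ ($1\le r\le p$), $\lambda_{p+1}=0$, $\nu_r=n_1+\cdots+n_r$, $$P_{\vec n}(x)=\sum_{l_1=0}^{n_1}\cdots\sum_{l_p=0}^{n_p}(-1)^{|\vec n|}\prod_{q=1}^p\left[\frac{(\alpha_q+1)_{n_q}}{(\alpha_q+\beta+|\vec n|+1)_{n_q}}\frac{(-n_q)_{l_q}}{l_q!}\right]\prod_{r=1}^{p}\frac{(\alpha_r+n_r+1)_{\lambda_{r+1}}(\alpha_r+\beta+\nu_r+\lambda_{r+1}+1)_{l_r}}{(\alpha_r+1)_{\lambda_r}}\;x^{l_1+\cdots+l_p}.$$ Type I: $P^{(i)}_{\vec n}=0$ if $n_i=0$, and if $n_i\ge1$ (all products over $q\in\{1,\dots,p\}$), $$P^{(i)}_{\vec n}(x)=(-1)^{|\vec n|-1}\frac{\Gamma(\alpha_i+\beta+|\vec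 n|+n_i)\prod_{q\ne i}(\alpha_q+\beta+|\vec n|)_{n_q}}{(n_i-1)!\,\Gamma(\beta+|\vec n|)\Gamma(\alpha_i+1)\prod_{q\neq i}(\alpha_q-\alpha_i)_{n_q}}\sum_{l=0}^{n_i-1}\frac{(-n_i+1)_l(\alpha_i+\beta+|\vec n|)_l}{l!\,(\alpha_i+1)_l}\prod_{q\ne i}\frac{(\alpha_i-\alpha_q-n_q+1)_l}{(\alpha_i-\alpha_q+1)_l}\,x^l .$$ Step line: for $m\ge0$, $k\in\{0,\dots,p-1\}$, let $\vec n(pm+k)$ be the multi-index whose first $k$ entries are $m+1$ and whose remaining $p-k$ entries are $m$; put $B_n=P_{\vec n(n)}$ and $A^{(i)}_n=P^{(i)}_{\vec n(n)}$ (in particular $A^{(i)}_0=0$). *)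

(* Defs.v *)
From HB Require Import structures.
From mathcomp Require Export all_boot all_order all_algebra.
From mathcomp Require Export all_classical all_reals all_analysis.

Set Implicit Arguments.
Unset Strict Implicit.
Unset Printing Implicit Defensive.

Import Order.TTheory GRing.Theory Num.Theory.
Import numFieldNormedType.Exports.

Local Open Scope classical_set_scope.
Local Open Scope ring_scope.

(* rising factorial (x)_n = x (x + 1) ... (x + n - 1) *)
Definition poch (R : realType) (x : R) (n : nat) : R :=
  \prod_(i < n) (x + i%:R).

(* Euler's integral; it is the Gamma function for x > 0, which is the only
   range in which it is used. *)
Definition Gamma (R : realType) (x : R) : R :=
  Rintegral (@lebesgue_measure R) `]0, +oo[
    (fun t : R => t `^ (x - 1) * expR (- t)).

Definition mnorm (p : nat) (n : 'I_p -> nat) : nat := (\sum_(q < p) n q)%N.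

(* A summation index (l_1, ..., l_p) with l_q <= n_q is encoded as a finite
   function into 'I_(|n| + 1) satisfying these inequalities. The ordinal r is
   0-based: the sums over r <= q, r < q and q <= r are lambda_r, lambda_(r+1)
   and nu_r. *)
Definition JP2 (R : realType) (p : nat) (alpha : 'rV[R]_p) (beta : R)
    (n : 'I_p -> nat) : {poly R} :=
  \sum_(l : {ffun 'I_p -> 'I_(mnorm n).+1} | [forall q, (l q <= n q)%N])
    ((-1) ^+ mnorm n
     * (\prod_(q < p)
          (poch (alpha 0 q + 1) (n q)
           / poch (alpha 0 q + beta + (mnorm n)%:R + 1) (n q)
           * (poch (- (n q)%:R) (l q) / ((l q)`!)%:R)))
     * (\prod_(r < p)
          (let lam := (\sum_(q < p | (r <= q)%N) l q)%N in
           let lam' := (\sum_(q < p | (r < q)%N) l q)%N in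
           let nu := (\sum_(q < p | (q <= r)%N) n q)%N in
           poch (alpha 0 r + (n r)%:R + 1) lam'
           * poch (alpha 0 r + beta + nu%:R + lam'%:R + 1) (l r)
           / poch (alpha 0 r + 1) lam)))
    *: 'X^(\sum_(q < p) l q)%N.

Definition JP1 (R : realType) (p : nat) (alpha : 'rV[R]_p) (beta : R)
    (n : 'I_p -> nat) (i : 'I_p) : {poly R} :=
  if n i == 0%N then 0 else
  ((-1) ^+ (mnorm n).-1
   * (Gamma (alpha 0 i + beta + (mnorm n)%:R + (n i)%:R)
      * \prod_(q < p | q != i) poch (alpha 0 q + beta + (mnorm n)%:R) (n q))
   / (((n i).-1)`!%:R * Gamma (beta + (mnorm n)%:R) * Gamma (alpha 0 i + 1)
      * \prod_(q < p | q != i) poch (alpha 0 q - alpha 0 i) (n q)))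
  *: \sum_(l < n i)
       ((poch (- (n i)%:R + 1) l * poch (alpha 0 i + beta + (mnorm n)%:R) l)
        / ((l`!)%:R * poch (alpha 0 i + 1) l)
        * \prod_(q < p | q != i)
            (poch (alpha 0 i - alpha 0 q - (n q)%:R + 1) l
             / poch (alpha 0 i - alpha 0 q + 1) l))
       *: 'X^l.

(* N = p m + k with k < p: the first k entries are m + 1, the others m. *)
Definition stepline (p : nat) (N : nat) : 'I_p -> nat :=
  fun q => (N %/ p + (q < N %% p))%N.

Definition stepB (R : realType) (p : nat) (alpha : 'rV[R]_p) (beta : R)
    (N : nat) : {poly R} :=
  JP2 alpha beta (@stepline p N).

Definition stepA (R : realType) (p : nat) (alpha : 'rV[R]_p) (beta : R)
    (i : 'I_p) (N : nat) : {poly R} :=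
  JP1 alpha beta (@stepline p N) i.

(* alpha_(r p + s) = alpha_s + r with 1 <= s <= p; here q >= 1 is the 1-based
   index r p + s (the default 0 is never reached when p > 0). *)
Definition alpha_ext (R : realType) (p : nat) (alpha : 'rV[R]_p) (q : nat) : R :=
  (if insub (q.-1 %% p)%N is Some s then alpha 0 (s : 'I_p) else 0)
  + (q.-1 %/ p)%:R.

(* The closed formula for b^j_(p m + k), 1-based in q and i and meant for
   j <= p, as a function of (alpha, beta). *)
Definition b_formula (R : realType) (p j m k : nat) (ab : 'rV[R]_p * R) : R :=
  let a := alpha_ext ab.1 in
  let beta := ab.2 in
  (a k.+1 + beta + ((p + 1) * m + k + 1)%:R - j%:R)
  / (\prod_(p + k + 2 - j <= q < p + k + 2)
       (a q + beta + ((p + 1) * m + k)%:R - j%:R))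
  * ((poch (beta + (p * m + k + 1)%:R - j%:R) j
      * \prod_(1 <= q < p.+1) poch (a q + beta + (p * m + k + 1)%:R - j%:R) j)
     / \prod_(k + 1 <= q < p + k + 1)
         poch (a q + beta + ((p + 1) * m + k + 1)%:R - j%:R) j)
  * \sum_(k + 1 <= i < p + k + 2 - j)
      ((a i + m%:R)
       / poch (a i + beta + ((p + 1) * m + k)%:R - j%:R) (j + 2)
       * (\prod_(1 <= q < p.+1) (a i - a q + m%:R)
          / \prod_(k + 1 <= q < p + k + 2 - j | q != i) (a i - a q))).

(* The points (alpha, beta) at which no denominator involving beta in
   b_formula vanishes. *)
Definition b_regular (R : realType) (p j m k : nat) : set ('rV[R]_p * R) :=
  [set ab | let a := alpha_ext ab.1 in
            let beta := ab.2 in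
    [/\ \prod_(p + k + 2 - j <= q < p + k + 2)
          (a q + beta + ((p + 1) * m + k)%:R - j%:R) != 0,
        \prod_(k + 1 <= q < p + k + 1)
          poch (a q + beta + ((p + 1) * m + k + 1)%:R - j%:R) j != 0
      & forall i : nat, (k + 1 <= i < p + k + 2 - j)%N ->
          poch (a i + beta + ((p + 1) * m + k)%:R - j%:R) (j + 2) != 0]].

(* the filter of regular parameters tending to ab *)
Definition b_nbhs (R : realType) (p j m k : nat) (ab : 'rV[R]_p * R) :
    set_system ('rV[R]_p * R) :=
  within (@b_regular R p j m k) (nbhs ab).

(* b^j_(p m + k): the closed formula where it makes sense, and its continuous
   extension elsewhere. *)
Definition b_coef_mk (R : realType) (p : nat) (alpha : 'rV[R]_p) (beta : R)
    (j m k : nat) : R :=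
  if `[< @b_regular R p j m k (alpha, beta) >]
  then b_formula j m k (alpha, beta)
  else lim (@b_formula R p j m k @ b_nbhs j m k (alpha, beta)).

Definition b_coef (R : realType) (p : nat) (alpha : 'rV[R]_p) (beta : R)
    (j n : nat) : R :=
  b_coef_mk alpha beta j (n %/ p) (n %% p).

(* Main.v *)
Require Import Defs.
From mathcomp Require Import measurable_realfun ring lra zify.

Set Implicit Arguments.
Unset Strict Implicit.
Unset Printing Implicit Defensive.

Import Order.TTheory GRing.Theory Num.Theory.
Import numFieldNormedType.Exports.
Local Open Scope classical_set_scope.
Local Open Scope ring_scope.

(** Put a_r = alpha_{r+1} for r < p and a_{r+p} = a_r + 1; along the step line
    the N-th multi-index occupies the nodes a_0, ..., a_{N-1}. In terms of these
    nodes both families become products, and multiplication by x becomes a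
    shift of a spectral variable t.

    - Type I: the coefficient of x^l in A^(i)_N is, with r = p l + i (i counted
      from 0), the residue at t = a_r of
        C_N Gamma(t+beta+N) / Gamma(t+1) / prod_{s<N} (t - a_s),
      where C_N = prod_{s<N} (a_s+beta+N) / Gamma(beta+N). This is coef_stepA; it
      uses the functional equation of Gamma.
    - Type II: the Mellin transform of x^k against (1-x)^beta, normalised by that
      of 1, is (t+1)_k / (t+beta+2)_k. The Mellin transform of B_N is a multiple
      of prod_{s<N} (t - a_s) / (t+beta+2)_N (mellin_stepB): summing the
      defining multiple sum over l_1 first is a Pfaff-Saalschutz summation, and
      what remains is a sum of the same kind with beta replaced by beta + n_1.
      A polynomial is determined by its Mellin transform (mellin_inj).

    Since t - 1 - a_s = t - a_{s+p}, a shift of t by one only moves the indices of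
    the nodes by p. After cancelling the common factors, each recurrence becomes
    a polynomial identity in t, and in both cases (for type II with t + 1 in place
    of t) it is the expansion of
      P(t) = t prod_{r<p} (t - a_r)
    in products prod_{s<=J} (t - z_s) prod_{r>J} (t - x_r), where x_0, ..., x_p
    are p + 1 consecutive nodes and the z_s are an arithmetic progression. The
    nodes are taken in increasing order for type I and in decreasing order for
    type II (type1_expansion, type2_expansion). The coefficients of such an
    expansion are sums of P(x_i) over i >= J with explicit denominators
    (mixed_newton), and the two orders give the same sums; this is why one
    formula serves both recurrences.

    The expansion requires x_i <> z_s, which holds as soon as no a_r + beta is an
    integer. After cancellation the closed formula for the coefficients becomes
    an expression, rcoef, whose denominators do not vanish for the given alpha
    and beta > -1.
    It is therefore the continuous extension of the closed formula (b_coefE), and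
    the identities pass to an arbitrary beta > -1 as limits from the right
    (type1_coef_rec, type2_rec). *)

(** * The functional equation of the Gamma integral *)

Section GammaFunction.
Variable R : realType.
Local Notation mu := (@lebesgue_measure R).

(** A term of degree at least x + 1 of the exponential series dominates t^(x+1). *)
Lemma ex_powR_expRN_le (x : R) :
  exists2 c : R, 0 < c & forall t, 1 <= t -> t `^ x * expR (- t) <= c / t.
Proof.
pose k := Num.truncn `|x|.
have xk : x <= k.+1%:R.
  by rewrite (le_trans (ler_norm x))// ltW// truncnS_gt.
exists (k.+2)`!%:R; first by rewrite ltr0n fact_gt0.
move=> t t1; have t0 : 0 < t by exact: lt_le_trans t1.
rewrite expRN ler_pdivrMr ?expR_gt0// mulrAC ler_pdivlMr//.
have h := expR_ge1Dxn k.+1 (ltW t0).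
have f0 : (0 : R) < (k.+2)`!%:R by rewrite ltr0n fact_gt0.
have le1 : t `^ x <= t ^+ k.+1 by rewrite -powR_mulrn ?(ltW t0)// ler_powR.
apply: (@le_trans _ _ (t ^+ k.+2)).
  by rewrite (exprSr t k.+1) ler_pM2r.
rewrite mulrC -ler_pdivrMr//; apply: le_trans h.
by rewrite lerDr.
Qed.

(** Integration by parts, carried out in the extended reals on the segments
    [1/(n+2), n+2]: the boundary terms t^x e^-t tend to 0 at both ends. *)
Lemma Gamma_rec (x : R) : 0 < x -> Gamma (x + 1) = x * Gamma x.
Proof.
move=> x0.
rewrite /Gamma /Rintegral.
have -> : x + 1 - 1 = x by ring.
pose D (n : nat) : set R := `[(n.+2%:R)^-1, n.+2%:R]%classic.
(* n + 1 exceeds both t and 1/t once n is the integer part of t + 1/t. *)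
have bigD : \bigcup_n D n = `]0, +oo[%classic.
  apply/seteqP; split => [t [n _]|t]; rewrite /D /= !in_itv /= ?andbT.
    by case/andP=> h _; rewrite (lt_le_trans _ h)// invr_gt0 ltr0n.
  move=> t0; exists (Num.truncn (t + t^-1)) => //.
  rewrite /= in_itv /=.
  have ti0 : 0 < t^-1 by rewrite invr_gt0.
  have h : t + t^-1 < (Num.truncn (t + t^-1)).+2%:R.
    rewrite (lt_le_trans (truncnS_gt _))// ler_nat//.
  apply/andP; split; last by rewrite ltW// (le_lt_trans _ h)// lerDl ltW.
  rewrite -[leRHS]invrK lef_pV2 ?posrE ?ltr0n//.
  by rewrite ltW// (le_lt_trans _ h)// lerDr ltW.
have ndD : nondecreasing_seq D.
  move=> m n mn; rewrite subsetEset /D => t /=; rewrite !in_itv /= => /andP[h1 h2].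
  apply/andP; split; last by rewrite (le_trans h2)// ler_nat; lia.
  by rewrite (le_trans _ h1)// lef_pV2 ?posrE ?ltr0n// ler_nat; lia.
have mD n : measurable (D n) by exact: measurable_itv.
have D0 n (t : R) : D n t -> 0 < t.
  by rewrite /D /= in_itv /= => /andP[h _]; rewrite (lt_le_trans _ h)// invr_gt0.
pose A := fun t : R => t `^ x * expR (- t).
pose B := fun t : R => t `^ (x - 1) * expR (- t).
have mA y (S : set R) : measurable_fun S (EFin \o (fun t : R => t `^ y * expR (- t))).
  apply/measurable_EFinP; apply: measurable_funTS; apply: measurable_funM => //.
  by apply: measurableT_comp => //; exact: measurable_funN.
have pos (y t : R) : (0 <= (t `^ y * expR (- t))%:E)%E.
  by rewrite lee_fin mulr_ge0 ?powR_ge0 ?expR_ge0.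
have cvgI y : (\int[mu]_(t in D n) (t `^ y * expR (- t))%:E @[n --> \oo] -->
     \int[mu]_(t in `]0%R, +oo[) (t `^ y * expR (- t))%:E)%E.
  rewrite -bigD; apply: ge0_nondecreasing_set_cvg_integral => //= i; exact: mA.
pose F n := A (n.+2%:R)^-1 - A n.+2%:R.
have parts n : (\int[mu]_(t in D n) (A t)%:E =
    (F n)%:E + x%:E * \int[mu]_(t in D n) (B t)%:E)%E.
  have ab : (n.+2%:R)^-1 < n.+2%:R :> R.
    rewrite (@lt_trans _ _ 1)// ?invf_lt1 ?ltr1n//.
  have dP (t z : R) : 0 < t -> derivable (@powR R ^~ z) t 1.
    by move=> t0; apply: derivable_powR; rewrite in_itv /= t0.
  have cE (t : R) : (fun t : R => expR (- t)) @ t --> expR (- t).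
    by apply: (@continuous_comp _ _ _ (@GRing.opp R) expR); [exact: opp_continuous|exact: continuous_expR].
  have cP (t z : R) : 0 < t -> (@powR R ^~ z) @ t --> t `^ z.
    by move=> /(dP _ z) /derivable1_diffP /differentiable_continuous.
  have dE (t : R) : is_derive t 1 (fun t : R => - expR (- t)) (expR (- t)).
    have h : is_derive t 1 (fun t : R => expR (- t)) (- expR (- t)).
      apply: is_derive_eq.
      by rewrite /GRing.scale/= mulrN1.
    by have := is_deriveN h; rewrite opprK.
  have ia0 : 0 < (n.+2%:R)^-1 :> R by rewrite invr_gt0 ltr0n.
  have b0 : 0 < n.+2%:R :> R by rewrite ltr0n.
  rewrite (@integration_by_parts R (@powR R ^~ x) (fun t => - expR (- t))
     (fun t => x * t `^ (x - 1)) (fun t => expR (- t)))//; first last.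
  - by move=> t _; rewrite derive1E; have [] := dE t.
  - split.
    + by move=> t _; have [] := dE t.
    + by apply: cvg_at_right_filter; apply: cvgN; exact: cE.
    + by apply: cvg_at_left_filter; apply: cvgN; exact: cE.
  - by apply: continuous_subspaceT => t; exact: cE.
  - by move=> t; rewrite in_itv /= => /andP[h _]; apply: powR_derive1; rewrite in_itv /= andbT (lt_trans _ h).
  - split.
    + by move=> t; rewrite in_itv /= => /andP[h _]; apply: dP; exact: lt_trans h.
    + by apply: cvg_at_right_filter; exact: cP.
    + by apply: cvg_at_left_filter; exact: cP.
  - apply/subspace_continuousP => t /=; rewrite in_itv /= => /andP[h _].
    have t0 : 0 < t by exact: lt_le_trans h.
    apply: cvg_within_filter; apply: cvgM; [exact: cvg_cst|exact: cP].
  congr (_ + _)%E; first by congr EFin; rewrite /F /A; ring.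
  have -> : (x%:E * \int[mu]_(t in D n) (B t)%:E = \int[mu]_(t in D n) (x%:E * (B t)%:E))%E.
    have /= -> // := @ge0_integralZl _ _ _ mu (D n) (mD n) (EFin \o B) (mA _ _) x%:E.
      by move=> t _; exact: pos.
    by rewrite lee_fin ltW.
  have h0 t : D n t -> (0 <= x%:E * (B t)%:E)%E.
    by move=> _; rewrite mule_ge0 ?pos// lee_fin ltW.
  have e := integral_ge0N mu h0.
  apply: (etrans _ (etrans (congr1 oppe e) (oppeK _))).
  congr (- _)%E; apply: eq_integral => t _; rewrite /B -EFinM -EFinN; congr EFin; ring.
have F0 : F n @[n --> \oo] --> (0 : R).
  have c1 : A (n.+2%:R)^-1 @[n --> \oo] --> (0 : R).
    have/cvg_at_rightP : A t @[t --> 0^'+] --> (0 : R).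
      rewrite -[X in _ --> X](mul0r (expR (- 0))).
      apply: cvgM; first exact: powR_cvg0.
      apply: cvg_at_right_filter.
      by apply: (@continuous_comp _ _ _ (@GRing.opp R) expR);
        [exact: opp_continuous|exact: continuous_expR].
    apply; split => [n|]; first by rewrite invr_gt0.
    by have := @cvg_harmonic R; rewrite -cvg_shiftS; apply.
  have c2 : A n.+2%:R @[n --> \oo] --> (0 : R).
    have [c c0 hc] := ex_powR_expRN_le x.
    apply: (@squeeze_cvgr _ _ _ _ (fun=> 0) (fun n => c * (n.+2%:R)^-1)).
    - apply: nearW => n; rewrite mulr_ge0 ?powR_ge0 ?expR_ge0//=.
      by apply: hc; rewrite ler1n.
    - exact: cvg_cst.
    - rewrite -[X in _ --> X](mulr0 c); apply: cvgM; first exact: cvg_cst.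
      by have := @cvg_harmonic R; rewrite -cvg_shiftS; apply.
  by rewrite -[X in _ --> X](subrr 0); apply: cvgB.
have cvgA := cvgI x.
have cvgB := cvgI (x - 1).
have cvgA' : (\int[mu]_(t in D n) (A t)%:E @[n --> \oo] -->
   0%:E + x%:E * \int[mu]_(t in `]0%R, +oo[) (B t)%:E)%E.
  under eq_cvg do rewrite parts.
  apply: cvgeD; first by rewrite fin_num_adde_defr.
    by apply: cvg_EFin => //; exact: nearW.
  by apply: cvgeZl.
have := cvg_unique _ cvgA cvgA'.
rewrite add0e => -> //.
case: (integral _ _ _) => [r|//|].
- by rewrite -EFinM.
- by rewrite gt0_muley ?lte_fin//= mulr0.
- by rewrite gt0_muleNy ?lte_fin//= mulr0.
Qed.
End GammaFunction.

(** * Newton interpolation with mixed nodes *)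

Section MixedNewton.
Variable F : fieldType.
Implicit Types (x z : nat -> F) (n i J : nat).

Lemma prod_nat_neq0 m n (Q : pred nat) (f : nat -> F) :
  (forall k, (m <= k < n)%N -> Q k -> f k != 0) ->
  \prod_(m <= k < n | Q k) f k != 0.
Proof.
move=> H; rewrite prodf_seq_neq0; apply/allP => k; rewrite mem_index_iota => kn.
by apply/implyP; exact: H.
Qed.

Lemma prod_nat_eq0 m n (Q : pred nat) (f : nat -> F) k :
  (m <= k < n)%N -> Q k -> f k = 0 -> \prod_(m <= k < n | Q k) f k = 0.
Proof.
move=> kn Qk fk; apply/eqP; rewrite prodf_seq_eq0; apply/hasP; exists k.
  by rewrite mem_index_iota.
by rewrite Qk fk eqxx.
Qed.

Lemma size_prod_nat_XsubC m n (Q : pred nat) x :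
  size (\prod_(m <= k < n | Q k) ('X - (x k)%:P)) = (count Q (index_iota m n)).+1.
Proof.
by rewrite -big_filter -(big_map x xpredT (fun c => 'X - c%:P)) size_prod_XsubC
  size_map size_filter.
Qed.

(** Lagrange interpolation at c, x 0, ..., x (n-1), with the node c singled out:
    in mixed_newton it is the first of the nodes z. *)
Lemma mixed_lagrange n x (c : F) (P : {poly F}) (t : F) :
  (size P <= n.+1)%N ->
  (forall i j, (i < n)%N -> (j < n)%N -> x i = x j -> i = j) ->
  (forall i, (i < n)%N -> x i != c) ->
  P.[t] = P.[c] / (\prod_(0 <= r < n) (c - x r)) * \prod_(0 <= r < n) (t - x r)
   + \sum_(0 <= i < n) P.[x i] / ((x i - c) * \prod_(0 <= r < n | r != i) (x i - x r))
       * ((t - c) * \prod_(0 <= r < n | r != i) (t - x r)).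
Proof.
move=> sP xinj xc.
pose L i : {poly F} := ('X - c%:P) * \prod_(0 <= r < n | r != i) ('X - (x r)%:P).
pose Q : {poly F} := (P.[c] / \prod_(0 <= r < n) (c - x r)) *: \prod_(0 <= r < n) ('X - (x r)%:P)
   + \sum_(0 <= i < n) (P.[x i] / ((x i - c) * \prod_(0 <= r < n | r != i) (x i - x r))) *: L i.
have hornerL i u : (L i).[u] = (u - c) * \prod_(0 <= r < n | r != i) (u - x r).
  by rewrite /L hornerM hornerXsubC horner_prod; congr (_ * _); apply: eq_bigr => r _; rewrite hornerXsubC.
have hornerQ u : Q.[u] = P.[c] / (\prod_(0 <= r < n) (c - x r)) * \prod_(0 <= r < n) (u - x r)
   + \sum_(0 <= i < n) P.[x i] / ((x i - c) * \prod_(0 <= r < n | r != i) (x i - x r))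
       * ((u - c) * \prod_(0 <= r < n | r != i) (u - x r)).
  rewrite /Q hornerD hornerZ horner_prod horner_sum; congr (_ * _ + _).
    by apply: eq_bigr => r _; rewrite hornerXsubC.
  by apply: eq_bigr => i _; rewrite hornerZ hornerL.
rewrite -hornerQ; suff /eqP h : P - Q == 0 by rewrite (subr0_eq h).
pose rs := c :: [seq x i | i <- iota 0 n].
have urs : uniq rs.
  rewrite /= map_inj_in_uniq ?iota_uniq ?andbT.
    apply/mapP => -[i]; rewrite mem_iota add0n => /andP[_ /= /xc /eqP h].
    by move/esym.
  by move=> i j; rewrite !mem_iota !add0n => /andP[_ ?] /andP[_ ?]; exact: xinj.
apply: contraT => nz; suff rts : all (root (P - Q)) rs.
  have := max_poly_roots nz rts urs.
  rewrite /= size_map size_iota ltnNge => /negP[].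
  rewrite (leq_trans (size_polyD _ _))// geq_max sP size_polyN.
  rewrite (leq_trans (size_polyD _ _))// geq_max.
  rewrite (leq_trans (size_scale_leq _ _)) /=; last first.
    by rewrite size_prod_nat_XsubC count_predT size_iota subn0.
  rewrite (leq_trans (size_sum _ _ _))//.
  apply/bigmax_leqP_seq => i; rewrite mem_index_iota => /andP[_ iln] _.
  rewrite (leq_trans (size_scale_leq _ _))// (leq_trans (size_polyMleq _ _))//.
  rewrite size_XsubC size_prod_nat_XsubC /= ltnS.
  have := count_predC (pred1 i) (index_iota 0 n).
  rewrite (count_uniq_mem _ (iota_uniq _ _)) mem_index_iota iln size_iota subn0.
  by rewrite (@eq_count _ (predC (pred1 i)) (fun r => r != i))//=; lia.
apply/allP => u; rewrite inE => /orP[/eqP->|/mapP[i]].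
  rewrite rootE hornerD hornerN hornerQ subrr.
  rewrite [X in _ - (_ + X)]big1 ?addr0; last by move=> i _; rewrite mul0r mulr0.
  rewrite divfK ?subrr//; apply: prod_nat_neq0 => k /andP[_ kn] _.
  by rewrite /= subr_eq0 eq_sym xc.
rewrite mem_iota add0n => /andP[_ /= iln] ->.
rewrite rootE hornerD hornerN hornerQ.
rewrite (@prod_nat_eq0 0 n xpredT (fun r => x i - x r) i) ?subrr// mulr0 add0r.
rewrite (bigD1_seq i) ?mem_index_iota ?iota_uniq//=.
rewrite [X in _ - (_ + X)]big1 ?addr0.
  rewrite divfK ?subrr// mulf_neq0 ?subr_eq0 ?xc//.
  apply: prod_nat_neq0 => k /andP[_ kn] ki; rewrite /= subr_eq0.
  by apply: contraNneq ki => /xinj ->.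
move=> k ki; rewrite [X in _ * (_ * X)](@prod_nat_eq0 _ _ _ _ i) ?mulr0// ?subrr//.
by rewrite eq_sym.
Qed.

(** A Lagrange basis polynomial in the mixed basis. Exchanging the factors
    (t - x J) / (x i - x J) for (t - z J.+1) / (x i - z J.+1) one at a time
    changes the product by a multiple of one mixed basis element, because
    (t - x) (y - z) - (t - z) (y - x) = (t - y) (x - z). *)
Lemma newton_telescope n x z i (t : F) : (i < n)%N ->
  (forall r, (r < n)%N -> r != i -> x i != x r) ->
  (forall s, (s <= i.+1)%N -> x i != z s) ->
  ((t - z 0%N) * \prod_(0 <= r < n | r != i) (t - x r)) /
    ((x i - z 0%N) * \prod_(0 <= r < n | r != i) (x i - x r)) =
  \sum_(0 <= J < i.+1) (x J - z J.+1) /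
    (\prod_(0 <= s < J.+2) (x i - z s) * \prod_(J <= r < n | r != i) (x i - x r)) *
    (\prod_(0 <= s < J.+1) (t - z s) * \prod_(J.+1 <= r < n) (t - x r)).
Proof.
move=> iln xi xz.
(* V 0 is the left-hand side, and V i the last summand. *)
pose V J := (\prod_(0 <= s < J.+1) (t - z s) * \prod_(J <= r < n | r != i) (t - x r)) /
  (\prod_(0 <= s < J.+1) (x i - z s) * \prod_(J <= r < n | r != i) (x i - x r)).
have Az J : (J <= i.+2)%N -> \prod_(0 <= s < J) (x i - z s) != 0.
  move=> Ji; apply: prod_nat_neq0 => s /andP[_ sJ] _ /=.
  by rewrite subr_eq0 xz//; lia.
have Bx J : \prod_(J <= r < n | r != i) (x i - x r) != 0.
  by apply: prod_nat_neq0 => r /andP[_ rn] ri /=; rewrite subr_eq0 xi.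
rewrite big_nat_recr //=.
transitivity (- (V i - V 0%N) + V i).
  by rewrite opprB subrK /V !big_nat1.
rewrite -telescope_sumr// -sumrN; congr (_ + _).
  apply: eq_big_nat => J /andP[_ Ji]; rewrite /V.
  have Jn : (J < n)%N by exact: ltn_trans iln.
  have JI : (J != i) by rewrite ltn_eqF.
have recr u k : \prod_(0 <= s < k.+1) (u - z s) = \prod_(0 <= s < k) (u - z s) * (u - z k).
    by rewrite big_nat_recr.
  rewrite 2!(recr _ J.+1) !(big_ltn_cond Jn) JI.
  have -> : \prod_(J.+1 <= r < n) (t - x r) =
    (t - x i) * \prod_(J.+1 <= r < n | r != i) (t - x r).
    by rewrite (bigD1_seq i) ?iota_uniq// mem_index_iota Ji iln.
  have h1 := Az J.+1 (leqW (leqW Ji)); have h2 := Bx J.+1.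
  have h3 : x i - z J.+1 != 0 by rewrite subr_eq0 xz// ltnW.
  have h4 : x i - x J != 0 by rewrite subr_eq0 xi.
  move: h1.
  move: (\prod_(0 <= s < J.+1) (x i - z s)) (\prod_(0 <= s < J.+1) (t - z s)).
  move: (\prod_(J.+1 <= r < n | r != i) (x i - x r)) h2.
  move: (\prod_(J.+1 <= r < n | r != i) (t - x r)) => B B' h2 A' A h1'.
  by field; rewrite h1' h2 h3 h4.
have -> : V i = (\prod_(0 <= s < i.+1) (t - z s) * \prod_(i.+1 <= r < n) (t - x r)) /
  (\prod_(0 <= s < i.+1) (x i - z s) * \prod_(i <= r < n | r != i) (x i - x r)).
  rewrite /V; congr (_ * _ / _).
  rewrite (big_ltn_cond iln) eqxx /= big_nat_cond [RHS]big_nat_cond.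
  by apply: eq_bigl => r; case: (ltngtP i r) => //= ir; rewrite ?andbT// gtn_eqF// andbT.
have h1 := Az i.+1 (leqnSn _).
have h2 := Bx i.
have h3 : x i - z i.+1 != 0 by rewrite subr_eq0 xz.
rewrite [\prod_(0 <= s < i.+2) _]big_nat_recr//=.
move: (\prod_(0 <= s < i.+1) (x i - z s)) (\prod_(0 <= s < i.+1) (t - z s)) h1.
move: (\prod_(i <= r < n | r != i) (x i - x r)) h2.
move: (\prod_(i.+1 <= r < n) (t - x r)) => B B' h2 A' A h1'.
by field; rewrite h1' h2 h3.
Qed.

Lemma sum_nat_triangle n (G : nat -> nat -> F) :
  \sum_(0 <= J < n) \sum_(J <= i < n) G J i = \sum_(0 <= i < n) \sum_(0 <= J < i.+1) G J i.
Proof.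
elim: n => [|n IH]; first by rewrite !big_nil.
rewrite [RHS]big_nat_recr//= -IH (big_nat_recr n)//= big_nat1.
rewrite (@eq_big_nat _ _ _ _ _ _ (fun J => \sum_(J <= i < n) G J i + G J n)).
  by rewrite big_split/= -addrA [X in _ = _ + X]big_nat_recr.
by move=> J /andP[_ Jn]; rewrite big_nat_recr// ltnW.
Qed.

(** Newton interpolation in which the factors t - x r are replaced, from the
    left, by factors t - z s. The J-th coefficient involves the values of P at
    x i for i >= J only. *)
Lemma mixed_newton n x z (P : {poly F}) (t : F) :
  (size P <= n.+1)%N ->
  (forall i j, (i < n)%N -> (j < n)%N -> x i = x j -> i = j) ->
  (forall i s, (i < n)%N -> (s <= i.+1)%N -> x i != z s) ->
  P.[t] = P.[z 0%N] / (\prod_(0 <= r < n) (z 0%N - x r)) * \prod_(0 <= r < n) (t - x r)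
   + \sum_(0 <= J < n) (x J - z J.+1) *
      (\sum_(J <= i < n) P.[x i] /
        (\prod_(0 <= s < J.+2) (x i - z s) * \prod_(J <= r < n | r != i) (x i - x r))) *
      (\prod_(0 <= s < J.+1) (t - z s) * \prod_(J.+1 <= r < n) (t - x r)).
Proof.
move=> sP xinj xz; rewrite (mixed_lagrange (c := z 0%N) _ sP xinj); last first.
  by move=> i iln; exact: xz.
congr (_ + _).
have -> : \sum_(0 <= J < n) (x J - z J.+1) *
      (\sum_(J <= i < n) P.[x i] /
        (\prod_(0 <= s < J.+2) (x i - z s) * \prod_(J <= r < n | r != i) (x i - x r))) *
      (\prod_(0 <= s < J.+1) (t - z s) * \prod_(J.+1 <= r < n) (t - x r)) =
  \sum_(0 <= J < n) \sum_(J <= i < n) P.[x i] * ((x J - z J.+1) /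
        (\prod_(0 <= s < J.+2) (x i - z s) * \prod_(J <= r < n | r != i) (x i - x r)) *
      (\prod_(0 <= s < J.+1) (t - z s) * \prod_(J.+1 <= r < n) (t - x r))).
  apply: eq_big_nat => J _; rewrite mulr_sumr mulr_suml.
  by apply: eq_bigr => i _; ring.
rewrite sum_nat_triangle; apply: eq_big_nat => i /andP[_ iln].
rewrite -mulr_sumr -newton_telescope//.
- by ring.
- by move=> r rn; apply: contraNneq => /xinj ->.
- by move=> s si; exact: xz.
Qed.
End MixedNewton.

(** * Shifted products and the two polynomial identities for generic parameters *)

Lemma big_nat_shift (R : Type) (op : R -> R -> R) (x : R) (k m n : nat) (P : pred nat) F :
  \big[op/x]_(k + m <= i < k + n | P i) F i =
  \big[op/x]_(m <= i < n | P (k + i)%N) F (k + i)%N.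
Proof.
rewrite [(k + m)%N]addnC big_addn addKn.
by under eq_bigl do rewrite addnC; under eq_bigr do rewrite addnC.
Qed.

Lemma big_nat_shift0 (R : Type) (op : R -> R -> R) (x : R) (k n : nat) (P : pred nat) F :
  \big[op/x]_(k <= i < k + n | P i) F i =
  \big[op/x]_(0 <= i < n | P (k + i)%N) F (k + i)%N.
Proof. by rewrite -{1}[k]addn0 big_nat_shift. Qed.

Lemma big_nat_rev_shift (R : Type) (x : R) (op : Monoid.com_law x) (c J p : nat) (P : pred nat) F :
  (J <= p.+1)%N ->
  \big[op/x]_(J <= i < p.+1 | P i) F (c + p - i)%N =
  \big[op/x]_(c <= i < c + (p.+1 - J) | P (c + p - i)%N) F i.
Proof.
move=> Jp; rewrite big_nat_rev -{1}[J]add0n big_addn big_nat_shift0.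
rewrite big_nat_cond [RHS]big_nat_cond.
apply: eq_big => [i|i /andP[/andP[_ ip] _]]; last by congr F; lia.
case: (boolP (0 <= i < p.+1 - J)%N) => //= ip; congr P; lia.
Qed.

Section Pochhammer.
Variable R : realType.
Implicit Types (x : R) (m n : nat).

Lemma pochE x n : poch x n = \prod_(0 <= i < n) (x + i%:R).
Proof. by rewrite /poch big_mkord. Qed.

Lemma poch0 x : poch x 0 = 1.
Proof. by rewrite /poch big_ord0. Qed.

Lemma pochSr x n : poch x n.+1 = poch x n * (x + n%:R).
Proof. by rewrite /poch big_ord_recr. Qed.

Lemma pochD x m n : poch x (m + n) = poch x m * poch (x + m%:R) n.
Proof.
elim: n => [|n IH]; first by rewrite addn0 poch0 mulr1.
by rewrite addnS !pochSr IH natrD addrA mulrA.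
Qed.

Lemma poch1 x : poch x 1 = x.
Proof. by rewrite pochSr poch0 mul1r addr0. Qed.

Lemma pochS x n : poch x n.+1 = x * poch (x + 1) n.
Proof. by rewrite -add1n pochD poch1. Qed.

Lemma poch_gt0 x n : 0 < x -> 0 < poch x n.
Proof. by move=> x0; apply: prodr_gt0 => i _; rewrite ltr_wpDr. Qed.

Lemma poch_neq0 x n : (forall i, (i < n)%N -> x + i%:R != 0) -> poch x n != 0.
Proof. by move=> H; apply/prodf_neq0 => i _; exact: H. Qed.

End Pochhammer.

Section StepSequence.
Variables (R : realType) (p : nat) (a : nat -> R).
Hypothesis aS : forall r, a (r + p)%N = a r + 1.
Implicit Types (w t beta : R).

Definition shiftprod w N := \prod_(0 <= r < N) (a r + w).

Definition shiftprodD1 w N i := \prod_(0 <= r < N | r != i) (a r + w).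

Lemma shiftprodS w N : shiftprod w N.+1 = shiftprod w N * (a N + w).
Proof. by rewrite /shiftprod big_nat_recr. Qed.

Lemma shiftprodD1E w N i : (i < N)%N ->
  shiftprod w N = (a i + w) * shiftprodD1 w N i.
Proof.
by move=> iN; rewrite /shiftprod (bigD1_seq i)//= ?mem_index_iota ?iota_uniq.
Qed.

Lemma shiftprod_shift w N :
  \prod_(p <= r < p + N) (a r + w) = shiftprod (w + 1) N.
Proof.
rewrite -{1}[p]add0n big_addn addKn /shiftprod.
by apply: eq_bigr => r _; rewrite aS addrAC addrA.
Qed.

(** Both sides are the product of a r + w over r < p + N, split in two ways. *)
Lemma shiftprod_swap w N : shiftprod w p * shiftprod (w + 1) N =
  shiftprod w N * \prod_(N <= r < N + p) (a r + w).
Proof.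
rewrite -shiftprod_shift /shiftprod -!big_cat_nat ?leq0n ?leq_addr//.
by rewrite addnC.
Qed.

Lemma shiftprod_swapS w k : shiftprod w p * shiftprod (w + 1) k.+1 =
  shiftprod w k * \prod_(k <= r < k + p.+1) (a r + w).
Proof.
rewrite shiftprod_swap shiftprodS -mulrA [in RHS]big_ltn; last by lia.
by rewrite addnS.
Qed.

(** The polynomial whose two mixed expansions are the recurrences; the nodes
    a r with r < p are the parameters alpha. *)
Definition nodepoly : {poly R} := 'X * \prod_(0 <= r < p) ('X - (a r)%:P).

Lemma size_nodepoly : size nodepoly = p.+2.
Proof.
rewrite /nodepoly mulrC size_mulX; last first.
  by rewrite prodf_seq_neq0; apply/allP => r _; rewrite polyXsubC_eq0.
by rewrite (size_prod_nat_XsubC 0 p xpredT) count_predT size_iota subn0.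
Qed.

Lemma horner_nodepoly t : nodepoly.[t] = t * \prod_(0 <= r < p) (t - a r).
Proof.
rewrite hornerM hornerX horner_prod; congr (_ * _).
by apply: eq_bigr => r _; rewrite hornerXsubC.
Qed.

Lemma nodepoly_root i : (i < p)%N -> nodepoly.[a i] = 0.
Proof.
by move=> ip; rewrite horner_nodepoly (@prod_nat_eq0 _ _ _ _ _ i) ?mulr0 ?subrr.
Qed.

(** The coefficient b^J_(k+J) after cancellation. The nodes below p are roots of
    nodepoly, hence the condition p <= i; for the others the factor
    a i + beta + k of the denominator of the closed formula equals
    a (i - p) + beta + k + 1, which occurs in the numerator and is removed there
    by shiftprodD1. *)
Definition rcoef beta k J : R :=
  poch (beta + k.+1%:R) J / shiftprod (beta + (k + J).+1%:R) (k + J)%N *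
  \sum_(k + J <= i < k + p.+1 | (p <= i)%N)
    shiftprodD1 (beta + k.+1%:R) k.+1 (i - p)%N * nodepoly.[a i] /
    (poch (a i + beta + k.+1%:R) J.+1 *
     \prod_(k + J <= r < k + p.+1 | r != i) (a i - a r)).

(** The form in which mixed_newton produces the coefficient. *)
Lemma rcoefE beta k J :
  (forall i, (k + J <= i < k + p.+1)%N -> (p <= i)%N -> a i + beta + k%:R != 0) ->
  rcoef beta k J =
  poch (beta + k.+1%:R) J * shiftprod (beta + k.+1%:R) k.+1 /
   shiftprod (beta + (k + J).+1%:R) (k + J)%N *
  \sum_(k + J <= i < k + p.+1) nodepoly.[a i] /
    (poch (a i + beta + k%:R) J.+2 *
     \prod_(k + J <= r < k + p.+1 | r != i) (a i - a r)).
Proof.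
move=> nz; rewrite /rcoef.
set S := (X in _ = _ * X); set u := poch _ _; set v := shiftprod _ (k + J)%N.
have -> : u * shiftprod (beta + k.+1%:R) k.+1 / v * S =
  u / v * (shiftprod (beta + k.+1%:R) k.+1 * S) by ring.
rewrite [_ * S]mulr_sumr.
congr (_ * _).
rewrite [RHS](bigID (fun i => (p <= i)%N)) /= [X in _ = _ + X]big1 ?addr0; last first.
  by move=> i; rewrite -ltnNge => ip; rewrite nodepoly_root// mul0r mulr0.
rewrite big_nat_cond [RHS]big_nat_cond; apply: eq_bigr => i /andP[ik pi].
have {}nz := nz i ik pi.
have h : a (i - p)%N + (beta + k.+1%:R) = a i + beta + k%:R.
  by rewrite -{2}(subnK pi) aS -natr1; ring.
rewrite (@shiftprodD1E _ _ (i - p)%N); last by lia.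
rewrite h (pochS (a i + beta + k%:R)).
have -> : a i + beta + k%:R + 1 = a i + beta + k.+1%:R by rewrite -natr1; ring.
rewrite !invfM; move: nz; move: (a i + beta + k%:R) (poch _ _)^-1 (\prod_(_ <= _ < _ | _) _)^-1 => c x y nz.
by field.
Qed.


Definition segpoly k t := \prod_(k <= r < k + p.+1) (t - a r).

Hypothesis a_inj : injective a.

(** The coefficient of the first element of the mixed basis. At t = - w all
    factors t - a r become - (a r + w), and shiftprod_swapS applies. *)
Lemma nodepoly_value_quot w k : shiftprod (w + 1) k.+1 != 0 ->
  \prod_(k <= r < k + p.+1) (a r + w) != 0 ->
  nodepoly.[- w] / \prod_(k <= r < k + p.+1) (- w - a r) =
  w * shiftprod w k / shiftprod (w + 1) k.+1.
Proof.
move=> nz1 nz2.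
have opp m n : \prod_(m <= r < n) (- w - a r) = (-1) ^+ (n - m) * \prod_(m <= r < n) (a r + w).
  rewrite -prodr_const_nat -big_split/=; apply: eq_bigr => r _.
  by rewrite mulN1r opprD addrC.
rewrite horner_nodepoly !opp subn0 addKn exprS.
rewrite -/(shiftprod w p).
have -> : shiftprod w p = shiftprod w k * \prod_(k <= r < k + p.+1) (a r + w) / shiftprod (w + 1) k.+1.
  by rewrite -shiftprod_swapS mulfK.
have : (-1) ^+ p != 0 :> R by rewrite signr_eq0.
move: nz1 nz2; move: (_ ^+ p) (shiftprod _ k.+1) (\prod_(k <= r < k + p.+1) (a r + w)).
move=> x y z y0 z0 x0; field.
by rewrite x0 y0 z0.
Qed.

(** Mixed expansion of nodepoly with the nodes a k, ..., a (k + p) in increasing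
    order and z s = - (beta + k + s). *)
Lemma type1_expansion beta k t : -1 < beta ->
  (forall r s, (s <= p.+2)%N -> a r + beta + (k + s)%:R != 0) ->
  shiftprod (beta + k.+1%:R) k.+1 * nodepoly.[t] =
  (beta + k%:R) * shiftprod (beta + k%:R) k * segpoly k t +
  \sum_(0 <= J < p.+1) rcoef beta k J *
     (shiftprod (beta + (k + J).+1%:R) (k + J).+1 / poch (beta + k.+1%:R) J) *
     (poch (t + beta + k%:R) J.+1 * \prod_(k + J.+1 <= r < k + p.+1) (t - a r)).
Proof.
move=> beta_gt nz.
rewrite (@mixed_newton _ p.+1 (fun i => a (k + i)%N) (fun s => - (beta + (k + s)%:R))); first last.
- move=> i s ip si; rewrite -subr_eq0 opprK addrA nz//; lia.
- by move=> i j _ _ /a_inj /addnI.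
- by rewrite size_nodepoly.
have Tnz w N : (forall r, (r < N)%N -> a r + w != 0) -> shiftprod w N != 0.
  by move=> H; apply: prod_nat_neq0 => r /andP[_ rN] _; exact: H.
have nz' r s : (s <= p.+2)%N -> a r + (beta + (k + s)%:R) != 0 by rewrite addrA; exact: nz.
have Tk1 : shiftprod (beta + k.+1%:R) k.+1 != 0.
  by apply: Tnz => r _; rewrite -addn1 nz'.
have Bk1 J : (J < p.+1)%N -> poch (beta + k.+1%:R) J != 0.
  by move=> _; rewrite gt_eqF// poch_gt0// -natr1; have := ler0n R k; lra.
rewrite addn0 mulrDr; congr (_ + _).
  have -> : \prod_(0 <= r < p.+1) (- (beta + k%:R) - a (k + r)%N) =
     \prod_(k <= r < k + p.+1) (- (beta + k%:R) - a r).
    by rewrite big_nat_shift0.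
  have -> : \prod_(0 <= r < p.+1) (t - a (k + r)%N) = segpoly k t.
    by rewrite /segpoly big_nat_shift0.
  have e : beta + k%:R + 1 = beta + k.+1%:R by rewrite -addrA natr1.
  rewrite nodepoly_value_quot; [rewrite e|by rewrite e|]; last first.
    by apply: prod_nat_neq0 => r _ _; have := nz' r 0%N isT; rewrite addn0.
  by field.
rewrite mulr_sumr; apply: eq_big_nat => J /andP[_ Jp].
rewrite rcoefE; last first.
  by move=> i _ _; have := nz i 0%N isT; rewrite addn0.
have -> : \sum_(J <= i < p.+1) nodepoly.[a (k + i)%N] /
   (\prod_(0 <= s < J.+2) (a (k + i)%N - - (beta + (k + s)%:R)) *
    \prod_(J <= r < p.+1 | r != i) (a (k + i)%N - a (k + r)%N)) =
  \sum_(k + J <= i < k + p.+1) nodepoly.[a i] /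
   (poch (a i + beta + k%:R) J.+2 * \prod_(k + J <= r < k + p.+1 | r != i) (a i - a r)).
  rewrite [RHS]big_nat_shift; apply: eq_bigr => i _; congr (_ / (_ * _)).
    by rewrite pochE; apply: eq_bigr => s _; rewrite opprK natrD; ring.
  by rewrite big_nat_shift; apply: eq_bigl => r; rewrite eqn_add2l.
have -> : \prod_(0 <= s < J.+1) (t - - (beta + (k + s)%:R)) = poch (t + beta + k%:R) J.+1.
  by rewrite pochE; apply: eq_bigr => s _; rewrite opprK natrD; ring.
have -> : \prod_(J.+1 <= r < p.+1) (t - a (k + r)%N) =
  \prod_(k + J.+1 <= r < k + p.+1) (t - a r) by rewrite big_nat_shift.
have -> : a (k + J)%N - - (beta + (k + J.+1)%:R) = a (k + J)%N + (beta + (k + J).+1%:R).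
  by rewrite opprK addnS.
rewrite (shiftprodS _ (k + J)%N).
have TkJ : shiftprod (beta + (k + J).+1%:R) (k + J) != 0.
  by apply: Tnz => r _; rewrite -addnS nz'//; lia.
have := Bk1 J Jp; move: (poch (beta + _) J) => y y0.
by field; rewrite y0 TkJ.
Qed.


(** The constant factor of the Mellin transform of the N-th type II polynomial;
    see mellin_stepB. *)
Definition mellin_norm beta N : R := poch (beta + 1) N / shiftprod (beta + N.+1%:R) N.

(** Mixed expansion of nodepoly with the nodes a N, ..., a (N + p) in decreasing
    order and z s = - (beta + N + 1 - s). Reading the sums over the nodes backwards
    turns them into those of type1_expansion for k = N - J. For J > N all the nodes
    concerned are roots of nodepoly. *)
Lemma type2_expansion beta N t : -1 < beta ->
  (forall r m n, a r + beta + m%:R - n%:R != 0) ->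
  mellin_norm beta N * nodepoly.[t] =
  mellin_norm beta N.+1 * segpoly N t +
  \sum_(0 <= J < p.+1 | (J <= N)%N) rcoef beta (N - J) J * mellin_norm beta (N - J) *
     (poch (t + beta + (N - J).+1%:R) J.+1 * \prod_(N <= r < N - J + p) (t - a r)).
Proof.
move=> beta_gt nz.
have nz' r n : a r + (beta + n%:R) != 0.
  by have := nz r n 0%N; rewrite subr0 addrA.
have Tnz n N' : shiftprod (beta + n%:R) N' != 0.
  by apply: prod_nat_neq0 => r _ _; exact: nz'.
rewrite (@mixed_newton _ p.+1 (fun i => a (N + p - i)%N) (fun s => - (beta + N.+1%:R - s%:R))); first last.
- by move=> i s ip si; rewrite -subr_eq0 opprK !addrA nz.
- by move=> i j ip jp /a_inj; lia.
- by rewrite size_nodepoly.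
rewrite subr0 mulrDr; congr (_ + _).
  have -> : \prod_(0 <= r < p.+1) (- (beta + N.+1%:R) - a (N + p - r)%N) =
     \prod_(N <= r < N + p.+1) (- (beta + N.+1%:R) - a r).
    by rewrite (@big_nat_rev_shift _ _ _ N 0 p xpredT (fun r => - (beta + N.+1%:R) - a r))// subn0.
  have -> : \prod_(0 <= r < p.+1) (t - a (N + p - r)%N) = segpoly N t.
    by rewrite (@big_nat_rev_shift _ _ _ N 0 p xpredT (fun r => t - a r))// subn0.
  have e : beta + N.+1%:R + 1 = beta + N.+2%:R by rewrite -addrA natr1.
  rewrite nodepoly_value_quot; [rewrite e|by rewrite e|]; last first.
    by apply: prod_nat_neq0 => r _ _; exact: nz'.
  rewrite /mellin_norm pochSr -[beta + 1 + _]addrA nat1r.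
  by field; rewrite !Tnz.
rewrite mulr_sumr [RHS]big_mkcond /=; apply: eq_big_nat => J /andP[_ Jp].
case: leqP => [JN|NJ]; last first.
  rewrite [X in _ * (_ * X * _)]big_nat_cond big1 ?(mulr0, mul0r)// => i /andP[/andP[Ji ip] _].
  by rewrite nodepoly_root ?mul0r//; lia.
set k := (N - J)%N.
have Nk : N = (k + J)%N by rewrite /k subnK.
rewrite rcoefE; last first.
  by move=> i _ _; rewrite -addrA nz'.
have Jp' : (J <= p.+1)%N by exact: ltnW.
have eN : (N + (p.+1 - J) = k + p.+1)%N by lia.
have -> : \sum_(J <= i < p.+1) nodepoly.[a (N + p - i)%N] /
   (\prod_(0 <= s < J.+2) (a (N + p - i)%N - - (beta + N.+1%:R - s%:R)) *
    \prod_(J <= r < p.+1 | r != i) (a (N + p - i)%N - a (N + p - r)%N)) =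
  \sum_(k + J <= i < k + p.+1) nodepoly.[a i] /
   (poch (a i + beta + k%:R) J.+2 * \prod_(k + J <= r < k + p.+1 | r != i) (a i - a r)).
  rewrite -Nk -eN.
  rewrite -(@big_nat_rev_shift _ _ _ N J p xpredT (fun i => nodepoly.[a i] /
   (poch (a i + beta + k%:R) J.+2 * \prod_(N <= r < N + (p.+1 - J) | r != i) (a i - a r))))//.
  apply: eq_big_nat => i /andP[Ji ip]; congr (_ / (_ * _)).
    rewrite pochE [RHS]big_nat_rev /=; apply: eq_big_nat => s /andP[_ sJ].
    rewrite opprK add0n subSS -!addrA -natrB; last by lia.
    by rewrite -natrD; congr (_ + (_ + _%:R)); lia.
  rewrite (@big_nat_rev_shift _ _ _ N J p (fun r => r != i) (fun r => a (N + p - i)%N - a r))//.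
  rewrite big_nat_cond [RHS]big_nat_cond; apply: eq_bigl => r.
  by case: (boolP (N <= r < N + (p.+1 - J))%N) => //= ir; congr (~~ _); apply/eqP/eqP; lia.
have -> : \prod_(0 <= s < J.+1) (t - - (beta + N.+1%:R - s%:R)) = poch (t + beta + k.+1%:R) J.+1.
  rewrite pochE [RHS]big_nat_rev /=; apply: eq_big_nat => s /andP[_ sJ].
  rewrite opprK add0n subSS -!addrA -natrB; last by lia.
  by rewrite -natrD; congr (_ + (_ + _%:R)); lia.
have -> : \prod_(J.+1 <= r < p.+1) (t - a (N + p - r)%N) = \prod_(N <= r < k + p) (t - a r).
  rewrite (@big_nat_rev_shift _ _ _ N J.+1 p xpredT (fun r => t - a r))//.
  by congr (\big[_/_]_(_ <= _ < _) _); lia.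
have -> : a (N + p - J)%N - - (beta + N.+1%:R - J.+1%:R) = a k + (beta + k.+1%:R).
  have -> : (N + p - J = k + p)%N by lia.
  rewrite aS opprK -(addrA beta) -natrB; last by lia.
  have -> : (N.+1 - J.+1 = k)%N by lia.
  by rewrite -natr1; ring.
rewrite /mellin_norm -Nk (shiftprodS _ k).
have Bk1 m n : poch (beta + m.+1%:R) n != 0.
  by rewrite gt_eqF// poch_gt0// -natr1; have := ler0n R m; lra.
have -> : poch (beta + 1) N = poch (beta + 1) k * poch (beta + k.+1%:R) J.
  by rewrite {1}Nk pochD -addrA nat1r.
by field; rewrite !Tnz.
Qed.
End StepSequence.

(** * Limits in the parameters *)

Section Limits.
Variables (R : realType) (T : Type) (F : set_system T).
Hypothesis FF : Filter F.

Lemma cvg_prodr (I : Type) (s : seq I) (P : pred I) (f : I -> T -> R) (l : I -> R) :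
  (forall i, P i -> f i x @[x --> F] --> l i) ->
  \prod_(i <- s | P i) f i x @[x --> F] --> \prod_(i <- s | P i) l i.
Proof. by apply: cvg_big; exact: mul_continuous. Qed.

Lemma cvg_sumr (I : Type) (s : seq I) (P : pred I) (f : I -> T -> R) (l : I -> R) :
  (forall i, P i -> f i x @[x --> F] --> l i) ->
  \sum_(i <- s | P i) f i x @[x --> F] --> \sum_(i <- s | P i) l i.
Proof. by apply: cvg_big; exact: add_continuous. Qed.

Lemma cvg_poch (f : T -> R) (l : R) n :
  f x @[x --> F] --> l -> poch (f x) n @[x --> F] --> poch l n.
Proof.
by move=> fl; apply: cvg_prodr => i _; apply: cvgD => //; exact: cvg_cst.
Qed.

(** The limit is taken along an arbitrary filter so that it serves both for
    beta alone and for all the parameters together. *)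
Lemma cvg_rcoef p (A : T -> nat -> R) (B : T -> R) (a : nat -> R) (beta : R) k J :
  (forall r, A x r @[x --> F] --> a r) -> B x @[x --> F] --> beta ->
  injective a -> (forall r, -1 < a r) -> (forall r, (p <= r)%N -> 0 < a r) ->
  -1 < beta ->
  rcoef p (A x) (B x) k J @[x --> F] --> rcoef p a beta k J.
Proof.
move=> Aa Bb a_inj a_gt a_gtp beta_gt; rewrite /rcoef.
have cS n w N : (A x n + (B x + w)) @[x --> F] --> (a n + (beta + w)).
  apply: cvgD => //; apply: cvgD => //; exact: cvg_cst.
apply: cvgM.
  apply: cvgM.
    by apply: cvg_poch; apply: cvgD => //; exact: cvg_cst.
  apply: cvgV; last by apply: cvg_prodr => r _; exact: cS.
  apply: prod_nat_neq0 => r /andP[_ rk] _; rewrite gt_eqF//.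
  have : (2%:R : R) <= (k + J).+1%:R by rewrite ler_nat; lia.
  by have := a_gt r; lra.
apply: cvg_sumr => i pi; apply: cvgM.
  apply: cvgM; first by apply: cvg_prodr => r _; exact: cS.
  under eq_cvg do rewrite horner_nodepoly.
  rewrite horner_nodepoly; apply: cvgM => //; apply: cvg_prodr => r _.
  by apply: cvgB.
apply: cvgV.
  rewrite mulf_neq0//.
    rewrite gt_eqF// poch_gt0// -natr1.
    by have := a_gtp i pi; have := ler0n R k; lra.
  apply: prod_nat_neq0 => r _ ri /=; rewrite subr_eq0.
  by apply: contraNneq ri => /a_inj ->.
apply: cvgM.
  by apply: cvg_poch; do !apply: cvgD => //; exact: cvg_cst.
by apply: cvg_prodr => r _; apply: cvgB.
Qed.

End Limits.

Section Perturbation.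
Variable R : realType.

Lemma near_right_not_int (c beta : R) :
  \forall b \near beta^'+, c + b \isn't a Num.int.
Proof.
(* The distance from c + beta to the next integer. *)
pose e := (Num.floor (c + beta))%:~R + 1 - (c + beta).
have e0 : 0 < e by rewrite /e subr_gt0 -intrD1 floorD1_gt ?num_real.
near=> b.
have b1 : beta < b by near: b; exact: nbhs_right_gt.
have b2 : b < beta + e by near: b; apply: nbhs_right_lt; rewrite ltrDl.
apply/negP => /intrP[z hz].
have h1 : Num.floor (c + beta) < z.
  rewrite -(ltr_int R) -hz (le_lt_trans (floor_le _))//; last by rewrite ltrD2l.
have h2 : (z%:~R : R) < (Num.floor (c + beta))%:~R + 1.
  by rewrite -hz; move: b2; rewrite /e; lra.
by move: h2; rewrite -intrD1 ltr_int; lia.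
Unshelve. all: by end_near. Qed.

(** How an identity between continuous functions of beta is extended from the
    generic values of beta. *)
Lemma cvg_right_eq0 (f : R -> R) (beta : R) :
  f b @[b --> beta^'+] --> f beta ->
  (\forall b \near beta^'+, f b = 0) -> f beta = 0.
Proof.
move=> cf f0; have h0 : f b @[b --> beta^'+] --> (0 : R) by exact: cvg_near_cst.
exact: (cvg_unique _ cf h0).
Qed.

End Perturbation.

(** * The two identities for every beta > -1 *)

Section StepRecurrences.
Variables (R : realType) (p : nat) (a : nat -> R).
Hypothesis p_gt0 : (0 < p)%N.
Hypothesis aS : forall r, a (r + p)%N = a r + 1.
Hypothesis a_inj : injective a.
Hypothesis a_gt : forall r, -1 < a r.
Implicit Types (beta t : R).

Lemma a_ge_p r : (p <= r)%N -> 0 < a r.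
Proof. by move=> pr; rewrite -(subnK pr) aS; have := a_gt (r - p)%N; lra. Qed.

Lemma a_divn r : a r = a (r %% p)%N + (r %/ p)%:R.
Proof.
rewrite {1}(divn_eq r p) addnC; elim: (r %/ p)%N => [|q IH].
  by rewrite mul0n addn0 addr0.
by rewrite mulSn addnCA addnC aS IH -natr1 addrA.
Qed.

(** No a r + beta is an integer: all divisions in the mixed expansions are then
    legitimate. *)
Definition generic_shift beta := forall r m n, a r + beta + m%:R - n%:R != 0.

Lemma near_generic_shift beta : \forall b \near beta^'+, generic_shift b.
Proof.
have h : \forall b \near beta^'+, forall i : 'I_p, a i + b \isn't a Num.int.
  by apply: filter_forall => i; exact: near_right_not_int.
apply: filterS h => b hb r m n; apply/eqP => e.
have /negP := hb (Ordinal (ltn_pmod r p_gt0)); apply => /=.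
have -> : a (r %% p)%N + b = n%:R - m%:R - (r %/ p)%:R.
  by move: e; rewrite a_divn; lra.
by rewrite !rpredB ?natr_int.
Qed.

(** With l = r %/ p and i = r %% p, the coefficient of x^l in the i-th type I
    polynomial for N, up to a factor that depends on i only. The factor
    poch (c + beta + 2) (l + N).-1 stands for Gamma (a r + beta + N + 1); together
    with shiftprodD1 it avoids the division by a r + beta + N, which may
    be 0 when N = 1. *)
Definition type1_coef beta N r : R :=
  if (r < N)%N then
    poch (a (r %% p)%N + beta + 2) (r %/ p + N).-1 *
    shiftprodD1 a (beta + N%:R) N r /
    (\prod_(0 <= s < N | s != r) (a r - a s)) /
    (poch (beta + 1) N.-1 * poch (a (r %% p)%N + 1) (r %/ p))
  else 0.

Lemma prod_split_neq N M r : (N <= M)%N ->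
  \prod_(0 <= s < M | s != r) (a r - a s) =
  \prod_(0 <= s < N | s != r) (a r - a s) * \prod_(N <= s < M | s != r) (a r - a s).
Proof. by move=> NM; rewrite -big_cat_nat. Qed.

Lemma prod_neq_neq0 m n r : \prod_(m <= s < n | s != r) (a r - a s) != 0.
Proof.
apply: prod_nat_neq0 => s _ sr /=; rewrite subr_eq0.
by apply: contraNneq sr => /a_inj ->.
Qed.

Lemma type1_coef0 beta N r : (N <= r)%N -> type1_coef beta N r = 0.
Proof. by rewrite /type1_coef ltnNge => ->. Qed.

(** The identity of type1_expansion at t = a r, divided by the product of the
    a r - a s over the other s < k + p + 1. A product over N <= s < k + p + 1 vanishes at
    a r unless r < N, which is exactly when the N-th polynomial has a coefficient
    of index r. *)
Lemma type1_coef_rec_generic beta k r : -1 < beta -> generic_shift beta ->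
  (if (p <= r)%N then type1_coef beta k.+1 (r - p) else 0) =
  type1_coef beta k r +
  \sum_(0 <= J < p.+1) rcoef p a beta k J * type1_coef beta (k + J).+1 r.
Proof.
move=> beta_gt nz.
have [rkp|rkp] := ltnP r (k + p.+1); last first.
  rewrite !type1_coef0 ?if_same; [|lia..].
  rewrite big_nat_cond big1 ?addr0// => J /andP[/andP[_ Jp] _].
  by rewrite type1_coef0 ?mulr0//; lia.
have nz' s n : a s + (beta + n%:R) != 0.
  by have := nz s n 0%N; rewrite subr0 addrA.
set c := a (r %% p)%N; set l := (r %/ p)%N.
have ar : a r = c + l%:R by exact: a_divn.
have c0 : c + beta + 1 != 0 by have := nz' (r %% p)%N 1%N; rewrite addrA.
have ark : a r + beta + k%:R != 0 by rewrite -addrA.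
have pb m n : poch (beta + m.+1%:R) n != 0.
  by rewrite gt_eqF// poch_gt0// -natr1; have := ler0n R m; lra.
have pb1 n : poch (beta + 1) n != 0 by exact: (pb 0%N).
have pc1 n : poch (c + 1) n != 0.
  by rewrite gt_eqF// poch_gt0//; have := a_gt (r %% p)%N; rewrite -/c; lra.
pose D := \prod_(0 <= s < k + p.+1 | s != r) (a r - a s).
have D0 : D != 0 by exact: prod_neq_neq0.
(* The ratio between the terms of the recurrence and those of type1_expansion. *)
pose G0 := poch (c + beta + 1) (l + k) /
  ((c + beta + 1) * (a r + beta + k%:R) * poch (beta + 1) k * poch (c + 1) l) / D.
have pc2 n : poch (c + beta + 2) n = poch (c + beta + 1) n.+1 / (c + beta + 1).
  by rewrite pochS mulrAC divff// mul1r; congr (poch _ _); ring.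
have Dsplit N : (r < N)%N -> (N <= k + p.+1)%N ->
   D = \prod_(0 <= s < N | s != r) (a r - a s) * \prod_(N <= s < k + p.+1) (a r - a s).
  move=> rN NM; rewrite /D (prod_split_neq _ NM); congr (_ * _).
  rewrite big_nat_cond [RHS]big_nat_cond; apply: eq_bigl => s.
  by case: (boolP (N <= s < _)%N) => //= /andP[Ns _]; rewrite gtn_eqF//; lia.
have Dzero N : (N <= r)%N -> \prod_(N <= s < k + p.+1) (a r - a s) = 0.
  by move=> Nr; rewrite (@prod_nat_eq0 _ _ _ _ _ r) ?subrr// Nr.
have claim1 J : (J < p.+1)%N -> type1_coef beta (k + J).+1 r =
   G0 * (shiftprod a (beta + (k + J).+1%:R) (k + J).+1 / poch (beta + k.+1%:R) J *
    (poch (a r + beta + k%:R) J.+1 * \prod_(k + J.+1 <= s < k + p.+1) (a r - a s))).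
  move=> Jp; have [Nr|rN] := leqP (k + J).+1 r.
    by rewrite type1_coef0// addnS Dzero ?mulr0.
  rewrite /type1_coef rN -/c -/l -addnS pc2.
  rewrite /G0 (Dsplit (k + J.+1)%N); [|by rewrite addnS|by lia].
  rewrite (@shiftprodD1E _ _ _ _ r); last by rewrite addnS.
  have -> : (l + (k + J.+1)).-1.+1 = (l + k + J.+1)%N by lia.
  have -> : (k + J.+1).-1 = (k + J)%N by lia.
  rewrite !pochD.
  have -> : beta + 1 + k%:R = beta + k.+1%:R by rewrite -addrA nat1r.
  have -> : c + beta + 1 + (l + k)%:R = a r + beta + k.+1%:R.
    by rewrite ar natrD -natr1; ring.
  rewrite (pochS (a r + _ + k%:R)) -(addrA _ k%:R) natr1 pochSr.
  have e : a r + beta + k.+1%:R + J%:R = a r + (beta + (k + J.+1)%:R).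
    by rewrite addnS -addSn natrD; ring.
  rewrite e.
  have h1 := nz' r (k + J.+1)%N.
  have h2 := prod_neq_neq0 0 (k + J.+1) r.
  have h3 : \prod_(k + J.+1 <= s < k + p.+1) (a r - a s) != 0.
    apply: prod_nat_neq0 => s /andP[ks _] _ /=; rewrite subr_eq0.
    by apply: contraTneq ks => /a_inj <-; rewrite -ltnNge addnS.
  have h4 := pb k J.
  field.
  by rewrite h2 h3 h4 ark c0 pb1 pc1.
(* For k <= r both sides vanish, a r being a root of segpoly. *)
have claim2 : type1_coef beta k r =
   G0 * ((beta + k%:R) * shiftprod a (beta + k%:R) k * segpoly p a k (a r)).
  have [kr|rk] := leqP k r; first by rewrite type1_coef0// /segpoly Dzero ?mulr0.
  rewrite /type1_coef rk -/c -/l pc2 /segpoly /G0 (Dsplit k) ?leq_addr//.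
  rewrite (@shiftprodD1E _ _ _ _ r)// addrA.
  case: k rk {rkp D D0 G0 Dsplit Dzero claim1} ark => // k rk ark.
  rewrite addnS /= (pochSr _ k).
  have h2 := prod_neq_neq0 0 k.+1 r.
  have h3 : \prod_(k.+1 <= s < k.+1 + p.+1) (a r - a s) != 0.
    apply: prod_nat_neq0 => s /andP[ks _] _ /=; rewrite subr_eq0.
    by apply: contraTneq ks => /a_inj <-; rewrite -ltnNge.
  have h4 : beta + k.+1%:R != 0 by rewrite -natr1; have := ler0n R k; lra.
  have -> : beta + 1 + k%:R = beta + k.+1%:R by rewrite -addrA nat1r.
  by field; rewrite nat1r h2 h3 h4 ark c0 pb1 pc1.
have claim3 : (if (p <= r)%N then type1_coef beta k.+1 (r - p) else 0) =
   G0 * (shiftprod a (beta + k.+1%:R) k.+1 * (nodepoly p a).[a r]).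
  case: leqP => [pr|rp]; last by rewrite nodepoly_root// !mulr0.
  have er : (r - p + p = r)%N by exact: subnK.
  have rk : (r - p < k.+1)%N by lia.
  have em : ((r - p) %% p = r %% p)%N by rewrite -{2}er modnDr.
  have el : l = ((r - p) %/ p).+1.
    by rewrite /l -{1}er divnDr ?dvdnn// divnn p_gt0 addn1.
  rewrite /type1_coef rk em -/c pc2.
  have ea : a (r - p)%N = a r - 1 by rewrite -{2}er aS addrK.
  rewrite (@shiftprodD1E _ _ _ _ (r - p)%N)//.
  have -> : a (r - p)%N + (beta + k.+1%:R) = a r + beta + k%:R.
    by rewrite ea -natr1; ring.
  have -> : \prod_(0 <= s < k.+1 | s != (r - p)%N) (a (r - p)%N - a s) =
      \prod_(p <= s < k + p.+1 | s != r) (a r - a s).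
    have -> : (k + p.+1 = p + k.+1)%N by lia.
    rewrite big_nat_shift0; apply: eq_big => [s|s _]; last by rewrite addnC aS ea; ring.
    by congr (~~ _); apply/eqP/eqP; lia.
  rewrite horner_nodepoly /G0 /D (@prod_split_neq p); last by lia.
  have -> : \prod_(0 <= s < p | s != r) (a r - a s) = \prod_(0 <= s < p) (a r - a s).
    rewrite big_nat_cond [RHS]big_nat_cond; apply: eq_bigl => s.
    by case: (boolP (0 <= s < p)%N) => //= sp; rewrite ltn_eqF//; lia.
  have h1 : \prod_(0 <= s < p) (a r - a s) != 0.
    apply: prod_nat_neq0 => s /andP[_ sp] _ /=; rewrite subr_eq0.
    by apply: contraTneq sp => /a_inj <-; rewrite -leqNgt.
  have h2 := prod_neq_neq0 p (k + p.+1) r.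
  have -> : (((r - p) %/ p + k.+1).-1.+1 = l + k)%N by rewrite el addnS addSn.
  rewrite el (pochSr _ ((r - p) %/ p)%N) /=.
  have h3 : a r != 0 by rewrite gt_eqF// a_ge_p.
  have <- : a r = c + 1 + ((r - p) %/ p)%:R by rewrite ar el -natr1; ring.
  by field; rewrite h1 h2 h3 ark c0 pb1 pc1.
rewrite claim3 claim2 type1_expansion//; last by move=> s n _; rewrite -addrA.
rewrite mulrDr mulr_sumr; congr (_ + _).
by apply: eq_big_nat => J /andP[_ Jp]; rewrite claim1//; ring.
Qed.

Lemma cvg_id_right beta : b @[b --> beta^'+] --> beta.
Proof. by apply: cvg_at_right_filter; exact: cvg_id. Qed.

Lemma cvg_type1_coef beta N r : -1 < beta ->
  type1_coef b N r @[b --> beta^'+] --> type1_coef beta N r.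
Proof.
move=> beta_gt; rewrite /type1_coef; case: ifP => _; last exact: cvg_cst.
have cD c : c + b @[b --> beta^'+] --> c + beta.
  by apply: cvgD; [exact: cvg_cst|exact: cvg_id_right].
have cDr (c : R) : b + c @[b --> beta^'+] --> beta + c.
  by apply: cvgD; [exact: cvg_id_right|exact: cvg_cst].
apply: cvgM.
  apply: cvgM; last exact: cvg_cst.
  apply: cvgM.
    by apply: cvg_poch; apply: cvgD; [exact: cD|exact: cvg_cst].
  by apply: cvg_prodr => s _; apply: cvgD; [exact: cvg_cst|exact: cDr].
apply: cvgV.
  rewrite mulf_neq0// gt_eqF// poch_gt0//; first by lra.
  by have := a_gt (r %% p)%N; lra.
by apply: cvgM; [apply: cvg_poch; exact: cDr|exact: cvg_cst].
Qed.

Lemma cvg_rcoef_right beta k J : -1 < beta ->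
  rcoef p a b k J @[b --> beta^'+] --> rcoef p a beta k J.
Proof.
move=> beta_gt; apply: (@cvg_rcoef _ _ _ _ _ (fun=> a)) => //.
- by move=> r; exact: cvg_cst.
- exact: cvg_id_right.
- exact: a_ge_p.
Qed.

Lemma near_right_gtN1 beta : -1 < beta -> \forall b \near beta^'+, -1 < b.
Proof.
move=> h; near=> b; apply: (lt_trans h); near: b; exact: nbhs_right_gt.
Unshelve. all: by end_near. Qed.

Lemma type1_coef_rec beta k r : -1 < beta ->
  (if (p <= r)%N then type1_coef beta k.+1 (r - p) else 0) =
  type1_coef beta k r +
  \sum_(0 <= J < p.+1) rcoef p a beta k J * type1_coef beta (k + J).+1 r.
Proof.
move=> beta_gt; apply/eqP; rewrite -subr_eq0; apply/eqP.
(* Both sides are continuous in beta from the right. *)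
pose f b := (if (p <= r)%N then type1_coef b k.+1 (r - p) else 0) -
  (type1_coef b k r +
  \sum_(0 <= J < p.+1) rcoef p a b k J * type1_coef b (k + J).+1 r).
apply: (@cvg_right_eq0 _ f).
  apply: cvgB.
    by case: ifP => _; [exact: cvg_type1_coef|exact: cvg_cst].
  apply: cvgD; first exact: cvg_type1_coef.
  by apply: cvg_sumr => J _; apply: cvgM; [exact: cvg_rcoef_right|exact: cvg_type1_coef].
near=> b; rewrite /f type1_coef_rec_generic ?subrr//.
  by near: b; exact: near_right_gtN1.
by near: b; exact: near_generic_shift.
Unshelve. all: by end_near. Qed.

Lemma cvg_mellin_norm beta N : -1 < beta ->
  mellin_norm a b N @[b --> beta^'+] --> mellin_norm a beta N.
Proof.
move=> beta_gt.
have cDr (c : R) : b + c @[b --> beta^'+] --> beta + c.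
  by apply: cvgD; [exact: cvg_id_right|exact: cvg_cst].
apply: cvgM; first by apply: cvg_poch; exact: cDr.
apply: cvgV.
  apply: prod_nat_neq0 => r /andP[_ rN] _; rewrite gt_eqF//.
  have : (2%:R : R) <= N.+1%:R by rewrite ler_nat; lia.
  by have := a_gt r; lra.
by apply: cvg_prodr => s _; apply: cvgD; [exact: cvg_cst|exact: cDr].
Qed.

Lemma type2_rec beta N t : -1 < beta ->
  mellin_norm a beta N * (nodepoly p a).[t] =
  mellin_norm a beta N.+1 * segpoly p a N t +
  \sum_(0 <= J < p.+1 | (J <= N)%N) rcoef p a beta (N - J) J * mellin_norm a beta (N - J) *
     (poch (t + beta + (N - J).+1%:R) J.+1 * \prod_(N <= r < N - J + p) (t - a r)).
Proof.
move=> beta_gt; apply/eqP; rewrite -subr_eq0; apply/eqP.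
pose f b := mellin_norm a b N * (nodepoly p a).[t] -
  (mellin_norm a b N.+1 * segpoly p a N t +
  \sum_(0 <= J < p.+1 | (J <= N)%N) rcoef p a b (N - J) J * mellin_norm a b (N - J) *
     (poch (t + b + (N - J).+1%:R) J.+1 * \prod_(N <= r < N - J + p) (t - a r))).
apply: (@cvg_right_eq0 _ f).
  apply: cvgB; first by apply: cvgM; [exact: cvg_mellin_norm|exact: cvg_cst].
  apply: cvgD; first by apply: cvgM; [exact: cvg_mellin_norm|exact: cvg_cst].
  apply: cvg_sumr => J _; apply: cvgM.
    by apply: cvgM; [exact: cvg_rcoef_right|exact: cvg_mellin_norm].
  apply: cvgM; last exact: cvg_cst.
  apply: cvg_poch; apply: cvgD; last exact: cvg_cst.
  by apply: cvgD; [exact: cvg_cst|exact: cvg_id_right].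
near=> b; rewrite /f type2_expansion ?subrr//.
  by near: b; exact: near_right_gtN1.
by near: b; exact: near_generic_shift.
Unshelve. all: by end_near. Qed.

End StepRecurrences.

(** * The closed formula after cancellation *)

Section Coefficients.
Variables (R : realType) (p : nat).
Hypothesis p_gt0 : (0 < p)%N.
Implicit Types (alpha : 'rV[R]_p) (beta : R).

Definition node alpha r : R := alpha_ext alpha r.+1.

Lemma node_ord alpha (i : 'I_p) : node alpha i = alpha 0 i.
Proof.
rewrite /node /alpha_ext /= modn_small// divn_small// addr0.
by rewrite valK.
Qed.

Lemma nodeS alpha r : node alpha (r + p)%N = node alpha r + 1.
Proof.
by rewrite /node /alpha_ext /= modnDr divnDr ?dvdnn// divnn p_gt0 natrD addrA.
Qed.

Lemma nodeDM alpha r m : node alpha (p * m + r)%N = node alpha r + m%:R.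
Proof.
elim: m => [|m IH]; first by rewrite muln0 addr0.
by rewrite mulnS -addnA addnC nodeS IH -natr1 addrA.
Qed.

Lemma node_gtN1 alpha : (forall i : 'I_p, -1 < alpha 0 i) -> forall r, -1 < node alpha r.
Proof.
move=> h r; rewrite (divn_eq r p) mulnC nodeDM.
rewrite -[(r %% p)%N]/(nat_of_ord (Ordinal (ltn_pmod r p_gt0))) node_ord.
by rewrite ltr_wpDr.
Qed.

(** Nodes in different residue classes modulo p differ by a non-integer, those
    in the same class by a nonzero integer. *)
Lemma node_inj alpha :
  (forall i j : 'I_p, i != j -> alpha 0 i - alpha 0 j \isn't a Num.int) ->
  injective (node alpha).
Proof.
move=> h r s; rewrite (divn_eq r p) (divn_eq s p) ![(_ * p)%N]mulnC !nodeDM.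
set i := Ordinal (ltn_pmod r p_gt0); set j := Ordinal (ltn_pmod s p_gt0).
rewrite -[(r %% p)%N]/(nat_of_ord i) -[(s %% p)%N]/(nat_of_ord j) !node_ord.
have [->|ij] := eqVneq i j.
  by move=> /addrI /eqP; rewrite eqr_nat => /eqP ->.
move=> e; have /negP[] := h _ _ ij.
have -> : alpha 0 i - alpha 0 j = (s %/ p)%:R - (r %/ p)%:R.
  by move: e; lra.
by rewrite rpredB ?natr_int.
Qed.

(** This reconciles the two shapes of the prefactor of the coefficients: the
    quotient of shifted products produced by the expansions and the quotient of
    Pochhammer symbols in the closed formula. Raising n by one moves the window
    of p nodes by one step. *)
Lemma shiftprod_poch (a : nat -> R) (aS : forall r, a (r + p)%N = a r + 1) w n j :
  \prod_(0 <= q < p) poch (a q + w) j * shiftprod a (w + j%:R) n =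
  shiftprod a w n * \prod_(n <= r < n + p) poch (a r + w) j.
Proof.
elim: n => [|n IH]; first by rewrite /shiftprod !big_nil mulr1 mul1r.
rewrite !shiftprodS mulrA IH (big_ltn (m := n)); last by lia.
rewrite addSn big_nat_recr /=; last by lia.
rewrite aS [a n + 1 + w]addrAC.
have : poch (a n + w) j * (a n + w + j%:R) = (a n + w) * poch (a n + w + 1) j.
  by rewrite -pochSr pochS.
set x := \prod_(n.+1 <= _ < _) _; rewrite addrA => e.
transitivity (shiftprod a w n * x * (poch (a n + w) j * (a n + w + j%:R))); first by ring.
by rewrite e; ring.
Qed.

(** The value 0 for j > p m + k is that of the closed formula: there m = 0, and
    the factor q = i makes every term of its sum vanish. *)
Definition bcoef_limit alpha beta j m k : R :=
  if (j <= p * m + k)%N then rcoef p (node alpha) beta (p * m + k - j) j else 0.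

Lemma b_formula_rcoef alpha beta j m k : (j <= p)%N -> (k < p)%N ->
  (forall i : 'I_p, -1 < alpha 0 i) -> -1 < beta ->
  b_regular j m k (alpha, beta) ->
  b_formula j m k (alpha, beta) = bcoef_limit alpha beta j m k.
Proof.
move=> jp kp alpha_gt beta_gt [/= reg1 reg2 reg3].
rewrite /b_formula /bcoef_limit /=; case: leqP => [jn|nj]; last first.
  have m0 : m = 0%N by case: m nj {reg1 reg2 reg3} => // m; rewrite mulnS; lia.
  rewrite m0 in nj *; rewrite [X in _ * X = _]big_nat_cond [X in _ * X = _]big1 ?mulr0// => i /andP[/andP[ki ip] _].
  rewrite (@prod_nat_eq0 _ 1 p.+1 xpredT _ i) ?mul0r ?mulr0//; first by lia.
  by rewrite subrr addr0.
set n := (p * m + k)%N in jn *; set k0 := (n - j)%N.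
have nk : n = (k0 + j)%N by rewrite /k0 subnK.
pose w := beta + k0.+1%:R.
have aE q s : (s + k = q)%N -> alpha_ext alpha q.+1 = node alpha (n + s)%N - m%:R.
  by move=> <-; rewrite /n -addnA nodeDM addrK addnC.
have cE (x : R) e : x + beta + ((p + 1) * m + k + e)%:R - j%:R = x + m%:R + (beta + (k0 + e)%:R).
  have -> : ((p + 1) * m + k + e = m + (k0 + e) + j)%N by lia.
  by rewrite !natrD; ring.
have bE e : beta + (n + e)%:R - j%:R = beta + (k0 + e)%:R.
  have -> : (n + e = k0 + e + j)%N by lia.
  by rewrite !natrD; ring.
have EA : alpha_ext alpha k.+1 + beta + ((p + 1) * m + k + 1)%:R - j%:R = node alpha n + w.
  by rewrite cE (aE k 0%N)// addn0 subrK addn1.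
have ED1 : \prod_(p + k + 2 - j <= q < p + k + 2)
      (alpha_ext alpha q + beta + ((p + 1) * m + k)%:R - j%:R) =
    \prod_(k0.+1 <= r < n.+1) (node alpha r + w).
  have e2 : (p + k + 2 = (p + k + 2 - j) + j)%N by lia.
  rewrite {2}e2.
  have -> : n.+1 = (k0.+1 + j)%N by lia.
  rewrite [LHS]big_nat_shift0 [RHS]big_nat_shift0; apply: eq_bigr => i _.
  have -> : (p + k + 2 - j + i = (p + 1 - j + i + k).+1)%N by lia.
  rewrite (aE _ (p + 1 - j + i)%N)// -[((p + 1) * m + k)%N]addn0 cE subrK addn0.
  have -> : (n + (p + 1 - j + i) = k0.+1 + i + p)%N by lia.
  by rewrite nodeS /w -natr1; ring.
have ED2 : \prod_(k + 1 <= q < p + k + 1)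
    poch (alpha_ext alpha q + beta + ((p + 1) * m + k + 1)%:R - j%:R) j =
    \prod_(n <= r < n + p) poch (node alpha r + w) j.
  have -> : (p + k + 1 = k + 1 + p)%N by lia.
  rewrite [LHS]big_nat_shift0 [RHS]big_nat_shift0; apply: eq_bigr => i _.
  have -> : (k + 1 + i = (i + k).+1)%N by lia.
  by rewrite (aE _ i)// cE subrK addn1.
have EP : \prod_(1 <= q < p.+1) poch (alpha_ext alpha q + beta + (n + 1)%:R - j%:R) j =
    \prod_(0 <= q < p) poch (node alpha q + w) j.
  rewrite big_add1; apply: eq_bigr => q _; congr (poch _ _).
  by rewrite /w -(addn1 k0) -bE /node; ring.
have ES : \sum_(k + 1 <= i < p + k + 2 - j)
      ((alpha_ext alpha i + m%:R)
       / poch (alpha_ext alpha i + beta + ((p + 1) * m + k)%:R - j%:R) (j + 2)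
       * (\prod_(1 <= q < p.+1) (alpha_ext alpha i - alpha_ext alpha q + m%:R)
          / \prod_(k + 1 <= q < p + k + 2 - j | q != i) (alpha_ext alpha i - alpha_ext alpha q))) =
   \sum_(k0 + j <= i < k0 + p.+1) (nodepoly p (node alpha)).[node alpha i] /
    (poch (node alpha i + beta + k0%:R) j.+2 *
     \prod_(k0 + j <= r < k0 + p.+1 | r != i) (node alpha i - node alpha r)).
  rewrite -nk.
  have -> : (p + k + 2 - j = k + 1 + (p.+1 - j))%N by lia.
  have -> : (k0 + p.+1 = n + (p.+1 - j))%N by lia.
  rewrite [LHS]big_nat_shift0 [RHS]big_nat_shift0; apply: eq_bigr => i _.
  have -> : (k + 1 + i = (i + k).+1)%N by lia.
  rewrite -[((p + 1) * m + k)%N]addn0 cE addn0 (aE _ i)// subrK horner_nodepoly.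
  have -> : \prod_(1 <= q < p.+1) (node alpha (n + i) - m%:R - alpha_ext alpha q + m%:R) =
     \prod_(0 <= q < p) (node alpha (n + i) - node alpha q).
    by rewrite big_add1; apply: eq_bigr => q _; rewrite /node; ring.
  have -> : \prod_(k + 1 <= q < k + 1 + (p.+1 - j) | q != (i + k).+1)
      (node alpha (n + i) - m%:R - alpha_ext alpha q) =
     \prod_(n <= r < n + (p.+1 - j) | r != (n + i)%N) (node alpha (n + i) - node alpha r).
    rewrite [LHS]big_nat_shift0 [RHS]big_nat_shift0; apply: eq_big => r.
      by congr (~~ _); apply/eqP/eqP; lia.
    have -> : (k + 1 + r = (r + k).+1)%N by lia.
    by rewrite (aE _ r)// => _; ring.
  by rewrite addn2 addrA invfM; ring.
have S0 : shiftprod (node alpha) (w + j%:R) n != 0.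
  apply: prod_nat_neq0 => r /andP[_ rn] _; rewrite gt_eqF// /w.
  have : (2%:R : R) <= k0.+1%:R + j%:R by rewrite -natrD ler_nat; lia.
  by have := node_gtN1 alpha_gt r; lra.
have reg3' i : (k0 + j <= i < k0 + p.+1)%N -> (p <= i)%N ->
    node alpha i + beta + k0%:R != 0.
  move=> ik _.
  have hi : (k + 1 <= (i - n + k).+1 < p + k + 2 - j)%N by lia.
  have := reg3 _ hi; rewrite (aE _ (i - n)%N)// subnKC; last by lia.
  rewrite -[((p + 1) * m + k)%N]addn0 cE addn0 subrK addn2 pochS mulf_eq0 negb_or.
  by rewrite addrA => /andP[].
rewrite rcoefE//; [|exact: nodeS].
rewrite EA ED1 ED2 EP ES bE addn1 -/w.
rewrite ED1 in reg1; rewrite ED2 in reg2.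
have -> : beta + (k0 + j).+1%:R = w + j%:R by rewrite /w -addSn natrD addrA.
rewrite -nk mulrA; congr (_ * _).
have := @shiftprod_poch (node alpha) (nodeS alpha) w n j.
have : shiftprod (node alpha) w k0.+1 * \prod_(k0.+1 <= r < n.+1) (node alpha r + w) =
   shiftprod (node alpha) w n * (node alpha n + w).
  by rewrite -shiftprodS /shiftprod -big_cat_nat//; lia.
move: reg1 reg2 S0.
move: (\prod_(k0.+1 <= _ < _) _) (\prod_(n <= _ < _) _) (shiftprod _ (w + j%:R) n).
move: (\prod_(0 <= _ < _) _) (shiftprod _ w n) (shiftprod _ w k0.+1) (node alpha n + w) (poch w j).
move=> x0 x1 x2 x3 x4 y1 y2 y3 n1 n2 n3 e1 e2.
have -> : x2 = x1 * x3 / y1 by rewrite -e1 mulfK.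
have -> : x0 = x1 * y2 / y3 by rewrite -e2 mulfK.
by field; rewrite n1 n2 n3.
Qed.
End Coefficients.

(** * The continuous extension of the closed formula *)

Section CoefficientLimits.
Variables (R : realType) (p : nat).
Hypothesis p_gt0 : (0 < p)%N.
Variables (alpha : 'rV[R]_p) (beta : R).
Hypothesis alpha_gt : forall i : 'I_p, -1 < alpha 0 i.
Hypothesis beta_gt : -1 < beta.
Hypothesis alphaB : forall i j : 'I_p, i != j -> alpha 0 i - alpha 0 j \isn't a Num.int.

Lemma cvg_fst_coord (i : 'I_p) :
  (fun ab : 'rV[R]_p * R => ab.1 0 i) @ (alpha, beta) --> alpha 0 i.
Proof.
apply: (@cvg_comp _ _ _ (@fst 'rV[R]_p R) (fun v : 'rV[R]_p => v 0 i) _ (nbhs alpha)).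
  exact: cvg_fst.
exact: coord_continuous.
Qed.

Lemma cvg_node r :
  (fun ab : 'rV[R]_p * R => node ab.1 r) @ (alpha, beta) --> node alpha r.
Proof.
rewrite /node /alpha_ext; apply: cvgD; last exact: cvg_cst.
case: insub => [i|]; [exact: cvg_fst_coord|exact: cvg_cst].
Qed.

Lemma cvg_bcoef_limit j m k :
  (fun ab : 'rV[R]_p * R => bcoef_limit ab.1 ab.2 j m k) @ (alpha, beta) -->
    bcoef_limit alpha beta j m k.
Proof.
rewrite /bcoef_limit; case: ifP => _; last exact: cvg_cst.
apply: cvg_rcoef => //.
- exact: cvg_node.
- exact: cvg_snd.
- exact: node_inj.
- exact: node_gtN1.
- apply: a_ge_p; [exact: nodeS|exact: node_gtN1].
Qed.

Lemma near_parameters_gtN1 :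
  \forall ab \near (alpha, beta),
    (forall i : 'I_p, -1 < (ab : 'rV[R]_p * R).1 0 i) /\ -1 < ab.2.
Proof.
have h1 : \forall ab \near (alpha, beta), forall i : 'I_p, -1 < (ab : 'rV[R]_p * R).1 0 i.
  have FF : Filter (nbhs (alpha, beta)) by exact: nbhs_filter.
  apply: (@filter_forall _ _ (fun (i : 'I_p) (ab : 'rV[R]_p * R) => is_true (-1 < ab.1 0 i)) _ FF) => i.
  by apply: (cvgr_gt (alpha 0 i)) => //; exact: cvg_fst_coord.
have h2 : \forall ab \near (alpha, beta), -1 < (ab : 'rV[R]_p * R).2.
  have c : (fun ab : 'rV[R]_p * R => ab.2) @ (alpha, beta) --> beta by exact: cvg_snd.
  by apply: (cvgr_gt beta c).
exact: filterI h1 h2.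
Qed.

Lemma cvg_b_formula j m k : (j <= p)%N -> (k < p)%N ->
  @b_formula R p j m k @ b_nbhs j m k (alpha, beta) --> bcoef_limit alpha beta j m k.
Proof.
move=> jp kp.
apply: (cvg_trans _ (cvg_within_filter _ (@cvg_bcoef_limit j m k))).
apply: near_eq_cvg; rewrite /b_nbhs near_withinE.
apply: filterS near_parameters_gtN1 => -[a b] [/= a_gt b_gt] reg; apply/esym.
exact: b_formula_rcoef.
Qed.

Lemma b_regular_generic b j m k : (j <= p)%N -> generic_shift (node alpha) b -> b_regular j m k (alpha, b).
Proof.
move=> jp gen; have nz q N N' : (0 < q)%N -> alpha_ext alpha q + b + N%:R - N'%:R != 0.
  by case: q => // q _; exact: gen.
have nzp q N N' l : (0 < q)%N -> poch (alpha_ext alpha q + b + N%:R - N'%:R) l != 0.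
  move=> q0; apply: poch_neq0 => i _; have := nz q (N + i)%N N' q0.
  by rewrite natrD; apply: contra_neq => h; rewrite -[RHS]h; ring.
split=> /=.
- by apply: prod_nat_neq0 => q /andP[pq _] _; apply: nz; lia.
- by apply: prod_nat_neq0 => q /andP[pq _] _; apply: nzp; lia.
- by move=> i /andP[ki _]; apply: nzp; lia.
Qed.

(** Regular parameters accumulate at (alpha, beta): move beta slightly to the
    right so that no alpha_i + beta is an integer. *)
Lemma b_nbhs_proper j m k : (j <= p)%N -> ProperFilter (b_nbhs j m k (alpha, beta)).
Proof.
move=> jp; apply: Build_ProperFilter_ex => P; rewrite /b_nbhs /within /= => hP.
have c : (alpha, b) @[b --> beta^'+] --> (alpha, beta).
  exact: (cvg_pair (cvg_cst alpha) (@cvg_id_right R beta)).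
have hP' : \forall b \near beta^'+, b_regular j m k (alpha, b) -> P (alpha, b) by exact: c hP.
have gen := near_generic_shift p_gt0 (nodeS p_gt0 alpha) beta.
have [b [h g]] := @filter_ex _ (beta^'+) (at_right_proper_filter beta) _ (filterI hP' gen).
by exists (alpha, b); apply: h; exact: b_regular_generic.
Qed.

Lemma b_coefE j n : (j <= p)%N ->
  b_coef alpha beta j n = if (j <= n)%N then rcoef p (node alpha) beta (n - j) j else 0.
Proof.
move=> jp; rewrite /b_coef /b_coef_mk.
have kp : (n %% p < p)%N by rewrite ltn_mod.
have -> : (if (j <= n)%N then rcoef p (node alpha) beta (n - j) j else 0) =
   bcoef_limit alpha beta j (n %/ p) (n %% p).
  by rewrite /bcoef_limit mulnC -divn_eq.
case: asboolP => reg; first exact: b_formula_rcoef.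
have FF := b_nbhs_proper (n %/ p) (n %% p) jp.
by apply: cvg_lim => //; exact: cvg_b_formula.
Qed.

End CoefficientLimits.

(** * Type I polynomials *)

Section Stepline.
Variable p : nat.
Hypothesis p_gt0 : (0 < p)%N.

Lemma steplineS N q : (q < p)%N ->
  (N.+1 %/ p + (q < N.+1 %% p) = N %/ p + (q < N %% p) + (q == N %% p))%N.
Proof.
move=> qp; rewrite modnS divnS//; have mp : (N %% p < p)%N by rewrite ltn_mod.
case: ifP => dv; last by rewrite ltnS leq_eqVlt; case: ltngtP => /= _; lia.
have : ((N %% p).+1 = p)%N.
  move: dv; rewrite {1}(divn_eq N p) -addnS dvdn_addr ?dvdn_mull// => /dvdn_leq; lia.
by case: ltngtP; lia.
Qed.

(** The nodes with index below N are those alpha_q + s with s < n_q. *)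
Lemma big_stepline (R : Type) (x : R) (op : Monoid.com_law x) (F : nat -> R) N :
  \big[op/x]_(q < p) \big[op/x]_(0 <= s < @stepline p N q) F (p * s + q)%N =
  \big[op/x]_(0 <= r < N) F r.
Proof.
elim: N => [|N IH].
  rewrite big_nil big1// => q _; rewrite /stepline div0n mod0n /= big_nil//.
rewrite big_nat_recr//= -IH.
pose q0 : 'I_p := Ordinal (ltn_pmod N p_gt0).
rewrite (bigD1 q0)//= [X in _ = op X _](bigD1 q0)//=.
have e0 : @stepline p N.+1 q0 = (@stepline p N q0).+1.
  by rewrite /stepline steplineS ?ltn_mod//= eqxx addn1.
have -> : F N = F (p * @stepline p N q0 + q0)%N.
  by congr F; rewrite /stepline /= ltnn addn0 {1}(divn_eq N p) mulnC.
rewrite e0 big_nat_recr//= -!Monoid.mulmA; congr (op _ _); rewrite [RHS]Monoid.mulmC; congr (op _ _).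
apply: eq_bigr => q qq0; rewrite /stepline steplineS ?ltn_ord// -[X in (_ + _ + X)%N]/(nat_of_bool (val q == val q0)).
by rewrite (inj_eq val_inj) (negbTE qq0) addn0.
Qed.

Lemma mnorm_stepline N : mnorm (@stepline p N) = N.
Proof.
rewrite /mnorm -[RHS]subn0 -[RHS]muln1 -sum_nat_const_nat -big_stepline.
by apply: eq_bigr => q _; rewrite sum_nat_const_nat subn0 muln1.
Qed.

Lemma stepline_gtE N (q : 'I_p) l : (l < @stepline p N q)%N = (p * l + q < N)%N.
Proof.
rewrite /stepline {3}(divn_eq N p) mulnC.
have := ltn_mod N p; rewrite p_gt0; have := ltn_ord q.
move: (N %/ p)%N (N %% p)%N (nat_of_ord q) => d m {}q qp mp.
have [ld|dl|->] := ltngtP l d.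
- have : (p * l.+1 <= p * d)%N by rewrite leq_mul2l ld orbT.
  by rewrite mulnS; case: (q < m)%N; lia.
- have : (p * d.+1 <= p * l)%N by rewrite leq_mul2l dl orbT.
  by rewrite mulnS; case: (q < m)%N; lia.
- by case: ltnP; lia.
Qed.

End Stepline.

Section FallingProducts.
Variable R : realType.

Lemma Gamma_poch (x : R) n : 0 < x -> Gamma (x + n%:R) = Gamma x * poch x n.
Proof.
move=> x0; elim: n => [|n IH]; first by rewrite addr0 poch0 mulr1.
by rewrite -natr1 addrA Gamma_rec ?ltr_wpDr// IH pochSr; ring.
Qed.

Lemma prod_falling_poch (y : R) n : \prod_(0 <= s < n) (y - s%:R) = (-1) ^+ n * poch (- y) n.
Proof.
elim: n => [|n IH]; first by rewrite big_nil poch0 mulr1.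
by rewrite big_nat_recr//= IH pochSr exprS; ring.
Qed.

Lemma prod_falling_rev (y : R) n : \prod_(0 <= s < n) (y - s%:R) = poch (y - n%:R + 1) n.
Proof.
rewrite pochE big_nat_rev /=; apply: eq_big_nat => s /andP[_ sn].
by rewrite add0n natrB// -natr1; ring.
Qed.

(** The two products are the halves of one Pochhammer symbol, split in two ways. *)
Lemma prod_shift_falling (y : R) n l : poch (y + 1) l != 0 ->
  \prod_(0 <= s < n) (y + l%:R - s%:R) * (poch (y - n%:R + 1) l / poch (y + 1) l) =
  (-1) ^+ n * poch (- y) n.
Proof.
move=> nz; rewrite -prod_falling_poch !prod_falling_rev.
have e : poch (y - n%:R + 1) l * poch (y + l%:R - n%:R + 1) n =
   poch (y - n%:R + 1) n * poch (y + 1) l.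
  have -> : y + l%:R - n%:R + 1 = y - n%:R + 1 + l%:R by ring.
  by rewrite -pochD addnC pochD; congr (_ * poch _ _); ring.
by rewrite mulrA [X in X / _]mulrC e mulfK.
Qed.

(** The analogue of prod_shift_falling at y = 0 with the vanishing factor left
    out. *)
Lemma prod_falling_skip n l : (l < n)%N ->
  \prod_(0 <= s < n | s != l) (l%:R - s%:R : R) * poch (- n%:R + 1) l =
  (-1) ^+ n.-1 * (n.-1)`!%:R * (l`!)%:R.
Proof.
case: n => // n; rewrite ltnS /= => ln.
have fact_prod m : (m`!)%:R = \prod_(0 <= s < m) (s.+1)%:R :> R.
  by rewrite fact_prod big_add1 natr_prod.
have p1 : poch (- n.+1%:R + 1) l = (-1) ^+ l * \prod_(0 <= i < l) (n - i)%:R :> R.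
  rewrite pochE -[l in (-1) ^+ l]subn0 -prodr_const_nat -big_split/=.
  apply: eq_big_nat => i /andP[_ il]; rewrite natrB; last by lia.
  by rewrite -natr1; ring.
have p2 : \prod_(0 <= s < n.+1 | s != l) (l%:R - s%:R : R) =
   (l`!)%:R * ((-1) ^+ (n - l) * ((n - l)`!)%:R).
  rewrite (big_cat_nat (n := l)) ?(leq_trans ln)//=; congr (_ * _).
    rewrite fact_prod big_nat_rev /= big_nat_cond [RHS]big_nat_cond.
    apply: eq_big => [s|s /andP[/andP[_ sl] _]].
      by case: (boolP (0 <= s < l)%N) => //= sl; rewrite ltn_eqF//; lia.
    rewrite add0n -natrB; last by lia.
    by congr (_%:R); lia.
  rewrite big_ltn_cond ?ltnS// eqxx /=.
  rewrite fact_prod -[X in (-1) ^+ X]subn0 -prodr_const_nat -big_split/=.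
  have -> : (n.+1 = l.+1 + (n - l))%N by lia.
  rewrite big_nat_shift0 big_nat_cond [RHS]big_nat_cond.
  apply: eq_big => [s|s _]; first by rewrite gtn_eqF//; lia.
  have -> : (l.+1 + s = l + s.+1)%N by lia.
  by rewrite natrD; ring.
rewrite p1 p2.
have <- : \prod_(0 <= i < l) (n - i)%:R * ((n - l)`!)%:R = (n`!)%:R :> R.
  by rewrite -natr_prod -natrM big_mkord -ffact_prod ffact_fact.
have -> : (-1) ^+ n = (-1) ^+ (n - l) * (-1) ^+ l :> R by rewrite -exprD subnK.
by ring.
Qed.

End FallingProducts.

Section TypeIRecurrence.
Variables (R : realType) (p : nat).
Hypothesis p_gt0 : (0 < p)%N.
Variables (alpha : 'rV[R]_p) (beta : R).
Hypothesis alpha_gt : forall i : 'I_p, -1 < alpha 0 i.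
Hypothesis beta_gt : -1 < beta.
Hypothesis alphaB : forall i j : 'I_p, i != j -> alpha 0 i - alpha 0 j \isn't a Num.int.

Definition type1_const i : R :=
  Gamma (alpha 0 i + beta + 2) / (Gamma (beta + 1) * Gamma (alpha 0 i + 1)).

Lemma prod_stepline_skip (F : nat -> R) N (i : 'I_p) l : (p * l + i < N)%N ->
  \prod_(0 <= r < N | r != (p * l + i)%N) F r =
  \prod_(0 <= s < @stepline p N i | s != l) F (p * s + i)%N *
  \prod_(q < p | q != i) \prod_(0 <= s < @stepline p N q) F (p * s + q)%N.
Proof.
move=> rN; rewrite big_mkcond /= -(big_stepline p_gt0) (bigD1 i)//=; congr (_ * _).
  rewrite [RHS]big_mkcond; apply: eq_bigr => s _.
  by rewrite eqn_add2r eqn_mul2l eqn0Ngt p_gt0.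
apply: eq_bigr => q qi; apply: eq_bigr => s _.
case: eqP => //= e; case/negP: qi; apply/eqP/val_inj => /=.
have := congr1 (modn^~ p) e.
by rewrite /= ![(p * _)%N]mulnC !modnMDl !modn_small.
Qed.

Lemma poch_shift_skip (x : R) n l : (l < n)%N ->
  poch x n * poch x l = poch x l.+1 * \prod_(0 <= s < n | s != l) (x + s%:R).
Proof.
move=> ln; rewrite {1}pochE (bigD1_seq l) ?mem_index_iota ?iota_uniq//= pochSr; ring.
Qed.

(** The products over q <> i and the factorials of the definition assemble into
    products over all nodes but a r; the Gamma factors are reduced to fixed
    arguments with Gamma_poch. *)
Lemma coef_stepA (i : 'I_p) N l :
  (stepA alpha beta i N)`_l =
  type1_const i * type1_coef p (node alpha) beta N (p * l + i).
Proof.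
rewrite /stepA /JP1 mnorm_stepline//.
set S := \sum_(_ < _) _.
pose E l := (poch (- (stepline N i)%:R + 1) l * poch (alpha 0 i + beta + N%:R) l)
        / ((l`!)%:R * poch (alpha 0 i + 1) l)
        * \prod_(q < p | q != i)
            (poch (alpha 0 i - alpha 0 q - (stepline N q)%:R + 1) l
             / poch (alpha 0 i - alpha 0 q + 1) l).
have -> : S = \poly_(l < stepline N i) E l by rewrite poly_def.
have [lN|] := ltnP l (stepline N i); last first.
  move=> nl; rewrite type1_coef0 ?mulr0; last by rewrite leqNgt -stepline_gtE// -leqNgt.
  case: ifP => _; first by rewrite coef0.
  by rewrite coefZ coef_poly ltnNge nl mulr0.
rewrite ifF; last by apply/eqP => e; rewrite e in lN.
rewrite coefZ coef_poly lN.
have rN : (p * l + i < N)%N by rewrite -stepline_gtE.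
rewrite /type1_coef rN.
have -> : ((p * l + i) %% p = i)%N by rewrite mulnC modnMDl modn_small.
have -> : ((p * l + i) %/ p = l)%N by rewrite mulnC divnMDl// divn_small// addn0.
rewrite node_ord.
have noder s (q : 'I_p) : node alpha (p * s + q)%N = alpha 0 q + s%:R.
  by rewrite nodeDM// node_ord.
rewrite /shiftprodD1 !(prod_stepline_skip _ rN).
set n := stepline N in lN *.
set x := alpha 0 i + beta + N%:R.
have -> : \prod_(0 <= s < n i | s != l) (node alpha (p * s + i) + (beta + N%:R)) =
    \prod_(0 <= s < n i | s != l) (x + s%:R).
  by apply: eq_bigr => s _; rewrite noder /x; ring.
have -> : \prod_(q < p | q != i) \prod_(0 <= s < n q) (node alpha (p * s + q) + (beta + N%:R)) =
    \prod_(q < p | q != i) poch (alpha 0 q + beta + N%:R) (n q).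
  by apply: eq_bigr => q _; rewrite pochE; apply: eq_bigr => s _; rewrite noder; ring.
have -> : \prod_(0 <= s < n i | s != l) (node alpha (p * l + i) - node alpha (p * s + i)) =
    \prod_(0 <= s < n i | s != l) (l%:R - s%:R).
  by apply: eq_bigr => s _; rewrite !noder; ring.
have -> : \prod_(q < p | q != i) \prod_(0 <= s < n q) (node alpha (p * l + i) - node alpha (p * s + q)) =
    \prod_(q < p | q != i) \prod_(0 <= s < n q) (alpha 0 i - alpha 0 q + l%:R - s%:R).
  by apply: eq_bigr => q _; apply: eq_bigr => s _; rewrite !noder; ring.
have N0 : (0 < N)%N by exact: leq_ltn_trans rN.
have niN : (0 < n i)%N by exact: leq_ltn_trans lN.
have leniN : (n i <= N)%N.
  by rewrite leqNgt stepline_gtE// -leqNgt (leq_trans _ (leq_addr _ _))// leq_pmull.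
have ab2 : 0 < alpha 0 i + beta + 2.
  by move: beta_gt (alpha_gt i); move: (alpha 0 i) => u; lra.
have b1 : 0 < beta + 1 by move: beta_gt; lra.
have EG1 : Gamma (x + (n i)%:R) = Gamma (alpha 0 i + beta + 2) * poch (alpha 0 i + beta + 2) (N + n i - 2)%N.
  rewrite -Gamma_poch//.
  rewrite natrB; last by lia.
  by rewrite natrD; congr Gamma; rewrite /x; ring.
have EG2 : Gamma (beta + N%:R) = Gamma (beta + 1) * poch (beta + 1) N.-1.
  by rewrite -Gamma_poch// -{1}(prednK N0) -nat1r addrA.
have EP : poch (alpha 0 i + beta + 2) (N + n i - 2)%N * poch x l =
   poch (alpha 0 i + beta + 2) (l + N).-1 * \prod_(0 <= s < n i | s != l) (x + s%:R).
  (* For N > 1 the Pochhammer symbol based at alpha_i + beta + 2 passes through x. *)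
  have [N1|N2] := leqP N 1.
    have eN : N = 1%N by apply/eqP; rewrite eqn_leq N1.
    have l0 : l = 0%N by move: rN; rewrite eN; case: (l) => // l'; rewrite mulnS; lia.
    have n1 : n i = 1%N.
      apply/eqP; rewrite eqn_leq niN andbT leqNgt stepline_gtE// eN muln1; lia.
    rewrite eN l0 n1 !poch0 big_mkcond big_nat1.
    by rewrite mulr1.
  have -> : (N + n i - 2 = N - 2 + n i)%N by lia.
  have -> : ((l + N).-1 = N - 2 + l.+1)%N by lia.
  rewrite (pochD _ (N - 2) (n i)) (pochD _ (N - 2) l.+1).
  have -> : alpha 0 i + beta + 2 + (N - 2)%:R = x by rewrite natrB// /x; ring.
  by rewrite -mulrA poch_shift_skip// mulrA.
pose W := \prod_(0 <= s < n i | s != l) (l%:R - s%:R : R).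
pose Z := \prod_(q < p | q != i) \prod_(0 <= s < n q) (alpha 0 i - alpha 0 q + l%:R - s%:R).
pose X := \prod_(q < p | q != i) poch (alpha 0 q - alpha 0 i) (n q).
pose Y := \prod_(q < p | q != i) (poch (alpha 0 i - alpha 0 q - (n q)%:R + 1) l
             / poch (alpha 0 i - alpha 0 q + 1) l).
have notint (q : 'I_p) (u v : nat) : q != i -> alpha 0 i - alpha 0 q + u%:R - v%:R != 0.
  move=> qi; have := alphaB qi; apply: contraNneq => e.
  have -> : alpha 0 q - alpha 0 i = u%:R - v%:R by rewrite -[LHS]addr0 -e; ring.
  by rewrite rpredB ?natr_int.
have Y0 q : q != i -> poch (alpha 0 i - alpha 0 q + 1) l != 0.
  move=> qi; apply: poch_neq0 => s _; have := notint q s.+1 0%N qi.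
  by rewrite subr0 -nat1r addrA.
have Z0 : Z != 0.
  apply/prodf_neq0 => q qi; apply: prod_nat_neq0 => s _ _ /=; exact: notint.
have W0 : W != 0.
  apply: prod_nat_neq0 => s _ sl /=; rewrite subr_eq0 eqr_nat eq_sym//.
have EZ : Z * Y = (-1) ^+ (N - n i) * X.
  rewrite /Z /Y /X -big_split/=.
  have -> : (N - n i = \sum_(q < p | q != i) n q)%N.
    by rewrite -{1}(mnorm_stepline p_gt0 N) /mnorm (bigD1 i)//= addKn.
  rewrite -prodrXr -big_split/=; apply: eq_bigr => q qi.
  by rewrite prod_shift_falling ?Y0// opprB.
have EW := @prod_falling_skip R (n i) l lN.
have Eq : X = (-1) ^+ (N - n i) * Z * Y by rewrite -mulrA EZ mulrA -expr2 sqrr_sign mul1r.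
rewrite /E -/n -/x -/W -/Z -/X -/Y EG1 EG2 Eq /type1_const.
have -> : poch (- (n i)%:R + 1) l = (-1) ^+ (n i).-1 * ((n i).-1)`!%:R * (l`!)%:R / W.
  by rewrite -EW mulrAC divff ?mul1r.
have -> : (-1) ^+ N.-1 = (-1) ^+ (N - n i) * (-1) ^+ (n i).-1 :> R.
  by rewrite -exprD; congr (_ ^+ _); have := leniN; lia.
have fl : (l`!)%:R != 0 :> R by rewrite pnatr_eq0 -lt0n fact_gt0.
have fn : ((n i).-1`!)%:R != 0 :> R by rewrite pnatr_eq0 -lt0n fact_gt0.
have Y00 : Y != 0.
  apply/prodf_neq0 => q qi; rewrite mulf_neq0 ?invr_eq0 ?Y0//.
  apply: poch_neq0 => s _; have := notint q s.+1 (n q) qi.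
  by rewrite -nat1r; apply: contra_neq => h; rewrite -[RHS]h; ring.
rewrite !invfM.
move: EP.
have s1 : (-1) ^+ (N - n i) != 0 :> R by rewrite signr_eq0.
have s2 : (-1) ^+ (n i).-1 * (-1) ^+ (n i).-1 = 1 :> R by rewrite -expr2 sqrr_sign.
clear EZ Eq EW; clearbody W Z Y.
move: s1 s2 fl fn W0 Z0 Y00.
move: ((-1) ^+ (N - n i)) ((-1) ^+ (n i).-1) (l`!)%:R ((n i).-1`!)%:R W Z Y => s1 s2 fl fn w z y.
move: (Gamma _)^-1 (Gamma _)^-1 (Gamma _) (poch (beta + 1) _)^-1 (poch (alpha 0 i + 1) _)^-1.
move: (\prod_(0 <= s < _ | _) _) (\prod_(q < p | _) _).
move: (poch _ (N + n i - 2)) (poch x l) (poch _ (l + N).-1).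
move=> c1 c2 c3 c4 c5 c6 c7 c8 c9 c10 s10 s2s fl0 fn0 w0 z0 y0 e.
transitivity (s2 * s2 * (c1 * c2) * (c8 * c5 * c6 * c7 * c9 * c10 / w / z)).
  by field; rewrite fl0 fn0 w0 z0 y0 s10.
by rewrite s2s e; ring.
Qed.

Lemma stepA_rec n i : (1 <= n)%N ->
  'X * stepA alpha beta i n = stepA alpha beta i n.-1 +
    b_coef alpha beta 0 n.-1 *: stepA alpha beta i n +
    \sum_(1 <= j < p.+1) b_coef alpha beta j (n + j).-1 *: stepA alpha beta i (n + j)%N.
Proof.
case: n => // k _; rewrite succnK.
have aS := nodeS p_gt0 alpha.
have := @type1_coef_rec R p (node alpha) p_gt0 aS (node_inj p_gt0 alphaB)
  (node_gtN1 p_gt0 alpha_gt) beta k.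
move=> rec; apply/polyP => l; rewrite coefXM !coefD coefZ coef_sum.
have {}rec := rec (p * l + i)%N beta_gt.
rewrite big_ltn// addn0 in rec.
rewrite b_coefE// subn0 !coef_stepA -addrA.
transitivity (type1_const i * (if (p <= p * l + i)%N
   then type1_coef p (node alpha) beta k.+1 (p * l + i - p) else 0)).
  case: l {rec} => [|l]; first by rewrite muln0 add0n leqNgt ltn_ord /= mulr0.
  by rewrite /= mulnS -addnA leq_addr addKn.
rewrite rec !mulrDr mulrCA; congr (_ + (_ + _)).
rewrite mulr_sumr; apply: eq_big_nat => j /andP[_ jp].
rewrite coefZ coef_stepA addSn succnK b_coefE// leq_addl addnK.
by rewrite mulrCA.
Qed.

End TypeIRecurrence.

(** * The Pfaff-Saalschutz summation *)

Section Saalschutz.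
Variable R : realType.
Implicit Types (alpha beta t : R) (G H : nat -> R).

Lemma sum_bin_diff n G :
  \sum_(0 <= l < n.+2) (-1) ^+ l * 'C(n.+1, l)%:R * G l =
  \sum_(0 <= l < n.+1) (-1) ^+ l * 'C(n, l)%:R * (G l - G l.+1).
Proof.
pose u l := (-1) ^+ l * 'C(n, l)%:R * G l.
have e1 : \sum_(0 <= l < n.+1) u l = u 0%N + \sum_(0 <= l < n.+1) u l.+1.
  rewrite -(@big_nat_recl _ _ +%R n.+1 0 u)//.
  by rewrite [RHS]big_nat_recr//= /u bin_small// mulr0 mul0r addr0.
transitivity (u 0%N + \sum_(0 <= l < n.+1) (u l.+1 - (-1) ^+ l * 'C(n, l)%:R * G l.+1)).
  rewrite big_nat_recl// /u !bin0; congr (_ + _).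
  by apply: eq_bigr => l _; rewrite binS natrD exprS; ring.
rewrite sumrB addrA -e1 -sumrB; apply: eq_bigr => l _; rewrite /u; ring.
Qed.

Lemma sum_bin_mul n H :
  \sum_(0 <= l < n.+2) (-1) ^+ l * 'C(n.+1, l)%:R * (l%:R * H l) =
  - (n.+1%:R * \sum_(0 <= l < n.+1) (-1) ^+ l * 'C(n, l)%:R * H l.+1).
Proof.
rewrite big_nat_recl// mul0r mulr0 add0r mulr_sumr -sumrN.
apply: eq_big_nat => l _.
have e : n.+1%:R * 'C(n, l)%:R = l.+1%:R * 'C(n.+1, l.+1)%:R :> R.
  by rewrite -!natrM mul_bin_diag.
transitivity (- ((-1) ^+ l * (l.+1%:R * 'C(n.+1, l.+1)%:R) * H l.+1)).
  by rewrite exprS; ring.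
by rewrite -e; ring.
Qed.

Lemma poch_diff (c : R) l : poch c l - poch (c + 1) l = - (l%:R * poch (c + 1) l.-1).
Proof.
case: l => [|l]; first by rewrite !poch0 subrr mul0r oppr0.
by rewrite pochS pochSr /= -natr1; ring.
Qed.

Let weight n alpha beta t l :=
  poch (alpha + 2 + l%:R) (n - l) * poch (t + 1) l * poch (t + beta + 3 + l%:R) (n - l).

(** The discrepancy between the recursion of the summands in n and that of the
    closed value in saalschutz. Pascal's rule turns it into
    - n (t + 1) times the same expression for n - 1, alpha + 1, t + 1. *)
Lemma saalschutz_step n alpha beta t (c := alpha + beta + n%:R + 2) :
  \sum_(0 <= l < n.+1) (-1) ^+ l * 'C(n, l)%:R * (weight n alpha beta t l *
    (poch c l * ((alpha - t) * (beta + 1) - n%:R * (t + 1 + l%:R)) -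
     (alpha - t) * (beta + 1) * poch (c + 1) l)) = 0.
Proof.
elim: n alpha t @c => [|n IH] alpha t c.
  by rewrite big_nat1 !poch0; ring.
(* H collects the difference of the two Pochhammer symbols, by poch_diff. *)
pose A := (alpha - t) * (beta + 1).
pose H l := weight n.+1 alpha beta t l * A * poch (c + 1) l.-1.
pose G l := n.+1%:R * (poch (alpha + 2 + l%:R) (n.+1 - l) * poch (t + 1) l.+1 *
    poch (t + beta + 3 + l%:R) (n.+1 - l)) * poch c l.
transitivity (- \sum_(0 <= l < n.+2) (-1) ^+ l * 'C(n.+1, l)%:R * (l%:R * H l)
   - \sum_(0 <= l < n.+2) (-1) ^+ l * 'C(n.+1, l)%:R * G l).
  rewrite -sumrN -sumrB; apply: eq_big_nat => l _.
  have e := poch_diff c l.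
  have -> : poch c l = poch (c + 1) l - l%:R * poch (c + 1) l.-1 by rewrite -e; ring.
  rewrite /H /G /A /weight (pochSr (t + 1)).
  have -> : poch c l = poch (c + 1) l - l%:R * poch (c + 1) l.-1 by rewrite -e; ring.
  by ring.
rewrite sum_bin_mul sum_bin_diff opprK mulr_sumr -sumrB.
have := IH (alpha + 1) (t + 1) => /(congr1 (fun x => - (n.+1%:R * (t + 1)) * x)).
rewrite mulr0 mulr_sumr => h; apply: (etrans _ h); clear h.
apply: eq_big_nat => l /andP[_ ln]; rewrite /H /G /A /weight /=.
have -> : (n.+1 - l = (n - l).+1)%N by lia.
have -> : (n.+1 - l.+1 = n - l)%N by lia.
have -> : alpha + 1 + beta + n%:R + 2 = c by rewrite /c -natr1; ring.
have -> : alpha + 2 + l.+1%:R = alpha + 2 + l%:R + 1 by rewrite -natr1; ring.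
have -> : t + beta + 3 + l.+1%:R = t + beta + 3 + l%:R + 1 by rewrite -natr1; ring.
have -> : alpha + 1 + 2 + l%:R = alpha + 2 + l%:R + 1 by ring.
have -> : t + 1 + beta + 3 + l%:R = t + beta + 3 + l%:R + 1 by ring.
rewrite !(pochS _ (n - l)) (pochSr c) (pochS (t + 1) l.+1) !(pochS (t + 1) l).
have -> : poch (t + 1 + 1) l.+1 = poch (t + 1 + 1) l * (t + 1 + 1 + l%:R) by rewrite pochSr.
have ec : c = alpha + beta + n%:R + 1 + 2 by rewrite /c -natr1; ring.
move: (poch c l) (poch (c + 1) l) => pc pc1; rewrite ec -!natr1; ring.
Qed.

(** The Pfaff-Saalschutz sum cleared of denominators. Pascal's rule lowers n;
    up to saalschutz_step, what comes out is (alpha - t) (beta + 1) times the sum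
    for n - 1, alpha + 1, beta + 1. *)
Lemma saalschutz n alpha beta t :
  \sum_(0 <= l < n.+1) (-1) ^+ l * 'C(n, l)%:R *
    (poch (alpha + beta + n%:R + 1) l * poch (alpha + 1 + l%:R) (n - l) *
     (poch (t + 1) l * poch (t + beta + 2 + l%:R) (n - l))) =
  poch (alpha - t) n * poch (beta + 1) n.
Proof.
elim: n alpha beta => [|n IH] alpha beta; first by rewrite big_nat1 bin0 subn0 !poch0; ring.
rewrite sum_bin_diff !pochS.
have -> : alpha - t + 1 = alpha + 1 - t by ring.
transitivity ((alpha - t) * (beta + 1) * (poch (alpha + 1 - t) n * poch (beta + 1 + 1) n)); last by ring.
rewrite -IH mulr_sumr.
have h := saalschutz_step n alpha beta t.
rewrite -[RHS]add0r -[X in _ = X + _]h -big_split/=; apply: eq_big_nat => l /andP[_ ln].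
have -> : (n.+1 - l = (n - l).+1)%N by lia.
have -> : (n.+1 - l.+1 = n - l)%N by lia.
have -> : alpha + 1 + (beta + 1) + n%:R + 1 = alpha + beta + n%:R + 2 + 1 by ring.
have -> : alpha + beta + n.+1%:R + 1 = alpha + beta + n%:R + 2 by rewrite -natr1; ring.
have -> : alpha + 1 + l.+1%:R = alpha + 2 + l%:R by rewrite -natr1; ring.
have -> : t + beta + 2 + l.+1%:R = t + beta + 3 + l%:R by rewrite -natr1; ring.
have -> : alpha + 1 + 1 + l%:R = alpha + 2 + l%:R by ring.
have -> : t + (beta + 1) + 2 + l%:R = t + beta + 3 + l%:R by ring.
rewrite /weight !(pochS _ (n - l)) !(pochSr _ l).
have -> : alpha + 1 + l%:R + 1 = alpha + 2 + l%:R by ring.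
have -> : t + beta + 2 + l%:R + 1 = t + beta + 3 + l%:R by ring.
move: (poch _ l) (poch _ l) => u v; ring.
Qed.

Lemma poch_opp_nat n l : (l <= n)%N ->
  poch (- n%:R : R) l / (l`!)%:R = (-1) ^+ l * 'C(n, l)%:R.
Proof.
move=> ln; have f0 : (l`!)%:R != 0 :> R by rewrite pnatr_eq0 -lt0n fact_gt0.
apply: (canLR (mulfK f0)); rewrite -mulrA -natrM bin_ffact ffact_prod natr_prod.
rewrite /poch -[l in (-1) ^+ l]card_ord -prodr_const -big_split/=.
by apply: eq_bigr => i _; rewrite natrB ?(leq_trans (ltnW (ltn_ord i)))//; ring.
Qed.

(** The summation over the first index l in the multiple sum: L stands for the
    sum of the other indices, and the last factor on the right shows that beta has
    become beta + n. *)
Lemma saalschutz_peel n L alpha beta t : -1 < alpha -> -1 < beta -> 0 <= t ->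
  \sum_(0 <= l < n.+1) poch (- n%:R) l / (l`!)%:R *
    (poch (alpha + n%:R + 1) L * poch (alpha + beta + n%:R + L%:R + 1) l /
       poch (alpha + 1) (l + L)) *
    (poch (t + 1) (l + L) / poch (t + beta + 2) (l + L)) =
  poch (beta + 1) n / poch (t + beta + 2) n * (poch (alpha - t) n / poch (alpha + 1) n) *
  (poch (t + 1) L / poch (t + (beta + n%:R) + 2) L).
Proof.
move=> a1 b1 t0.
have p0 (x : R) m : 0 < x -> poch x m != 0 by move=> x0; rewrite gt_eqF// poch_gt0.
have Lr : 0 <= L%:R :> R by exact: ler0n.
have nr : 0 <= n%:R :> R by exact: ler0n.
have := saalschutz n (alpha + L%:R) beta (t + L%:R).
have -> : alpha + L%:R - (t + L%:R) = alpha - t by ring.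
move=> h.
have -> : poch (beta + 1) n / poch (t + beta + 2) n * (poch (alpha - t) n / poch (alpha + 1) n) *
  (poch (t + 1) L / poch (t + (beta + n%:R) + 2) L) =
  (poch (alpha - t) n * poch (beta + 1) n) *
  (poch (t + 1) L / (poch (alpha + 1) n * (poch (t + beta + 2) n * poch (t + (beta + n%:R) + 2) L))).
  rewrite !invfM; ring.
rewrite -h mulr_suml; apply: eq_big_nat => l /andP[_ ln].
rewrite poch_opp_nat//.
have -> : t + (beta + n%:R) + 2 = t + beta + 2 + n%:R by ring.
rewrite -pochD [(n + L)%N]addnC [(l + L)%N]addnC.
have -> : poch (t + beta + 2) (L + n) = poch (t + beta + 2) (L + l) * poch (t + L%:R + beta + 2 + l%:R) (n - l).
  rewrite -[in LHS](subnKC (ln : (l <= n)%N)) addnA pochD; congr (_ * poch _ _).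
  by rewrite natrD; ring.
have e : poch (alpha + 1) n * poch (alpha + n%:R + 1) L =
   poch (alpha + 1) (L + l) * poch (alpha + L%:R + 1 + l%:R) (n - l).
  have -> : alpha + n%:R + 1 = alpha + 1 + n%:R by ring.
  rewrite -pochD addnC -{1}(subnKC (ln : (l <= n)%N)) addnA pochD; congr (_ * poch _ _).
  by rewrite natrD; ring.
have -> : poch (alpha + n%:R + 1) L = poch (alpha + 1) (L + l) * poch (alpha + L%:R + 1 + l%:R) (n - l) / poch (alpha + 1) n.
  by rewrite -e mulrC mulKf// p0//; lra.
rewrite (pochD (t + 1)).
have -> : t + 1 + L%:R = t + L%:R + 1 by ring.
have -> : alpha + L%:R + beta + n%:R + 1 = alpha + beta + n%:R + L%:R + 1 by ring.
have q1 : poch (alpha + 1) (L + l) != 0 by rewrite p0//; lra.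
have q2 : poch (alpha + 1) n != 0 by rewrite p0//; lra.
have q3 : poch (t + beta + 2) (L + l) != 0 by rewrite p0//; lra.
have q4 : poch (t + L%:R + beta + 2 + l%:R) (n - l) != 0.
  by rewrite p0//; have := ler0n R l; lra.
by field; rewrite q1 q2 q3 q4.
Qed.

End Saalschutz.

(** * The multiple sum of the type II polynomials *)

Section MultiSum.
Variable R : realType.

Definition ffun_cons p K (u : 'I_K * {ffun 'I_p -> 'I_K}) : {ffun 'I_p.+1 -> 'I_K} :=
  [ffun q => if unlift ord0 q is Some j then u.2 j else u.1].

Lemma ffun_cons0 p K (u : 'I_K * {ffun 'I_p -> 'I_K}) : ffun_cons u ord0 = u.1.
Proof. by rewrite ffunE unlift_none. Qed.

Lemma ffun_cons_lift p K (u : 'I_K * {ffun 'I_p -> 'I_K}) j : ffun_cons u (lift ord0 j) = u.2 j.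
Proof. by rewrite ffunE liftK. Qed.

Lemma ffun_cons_bij p K : bijective (@ffun_cons p K).
Proof.
exists (fun l : {ffun 'I_p.+1 -> 'I_K} => (l ord0, [ffun j : 'I_p => l (lift ord0 j)])).
  case=> x l; congr (_, _); first by rewrite ffun_cons0.
  by apply/ffunP => j; rewrite ffunE ffun_cons_lift.
move=> l; apply/ffunP => q; rewrite ffunE; case: unliftP => [j ->|->] //=.
by rewrite ffunE.
Qed.

Lemma big_ord_lift_cond (S : Type) (x : S) (op : Monoid.com_law x) p (P : pred 'I_p.+1) (F : 'I_p.+1 -> S) :
  \big[op/x]_(q < p.+1 | P q) F q =
  op (if P ord0 then F ord0 else x) (\big[op/x]_(j < p | P (lift ord0 j)) F (lift ord0 j)).
Proof. by rewrite big_mkcond big_ord_recl -big_mkcond. Qed.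

(** Induction on p, the first index being summed by saalschutz_peel. *)
Lemma multi_saalschutz p K (alpha : 'I_p -> R) (n : 'I_p -> nat) (beta t : R) :
  (forall q, n q < K)%N -> (forall q, -1 < alpha q) -> -1 < beta -> 0 <= t ->
  \sum_(l : {ffun 'I_p -> 'I_K} | [forall q, (l q <= n q)%N])
   (\prod_(q < p) (poch (- (n q)%:R) (l q) / ((l q)`!)%:R)) *
   (\prod_(r < p)
          (let lam := (\sum_(q < p | (r <= q)%N) l q)%N in
           let lam' := (\sum_(q < p | (r < q)%N) l q)%N in
           let nu := (\sum_(q < p | (q <= r)%N) n q)%N in
           poch (alpha r + (n r)%:R + 1) lam'
           * poch (alpha r + beta + nu%:R + lam'%:R + 1) (l r)
           / poch (alpha r + 1) lam)) *
   (poch (t + 1) (\sum_(q < p) l q)%N / poch (t + beta + 2) (\sum_(q < p) l q)%N) =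
  poch (beta + 1) (\sum_(q < p) n q)%N / poch (t + beta + 2) (\sum_(q < p) n q)%N *
  \prod_(q < p) (poch (alpha q - t) (n q) / poch (alpha q + 1) (n q)).
Proof.
elim: p alpha n beta => [|p IH] alpha n beta nK a1 b1 t0.
  rewrite (eq_bigl predT) => [|l]; last by apply/forallP => -[].
  rewrite (eq_bigr (fun=> 1)) => [|l _].
    by rewrite sumr_const card_ffun !card_ord expn0 !big_ord0 !poch0; field.
  by rewrite !big_ord0 !poch0; field.
rewrite (reindex (@ffun_cons p K)) /=; last first.
  exact: onW_bij (ffun_cons_bij p K).
set n' := fun j : 'I_p => n (lift ord0 j).
set alpha' := fun j : 'I_p => alpha (lift ord0 j).
set n0 := n ord0.
have condE (u : 'I_K * {ffun 'I_p -> 'I_K}) : [forall q, (ffun_cons u q <= n q)%N] = 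
   (u.1 <= n0)%N && [forall j, (u.2 j <= n' j)%N].
  apply/forallP/andP => [h|[h0 h] q].
    split; first by have := h ord0; rewrite ffun_cons0.
    by apply/forallP => j; have := h (lift ord0 j); rewrite ffun_cons_lift.
  case: (unliftP ord0 q) => [j ->|->]; last by rewrite ffun_cons0.
  by rewrite ffun_cons_lift; exact: (forallP h).
rewrite (eq_bigl _ _ condE).
pose T (l : {ffun 'I_p -> 'I_K}) :=
   (\prod_(q < p) (poch (- (n' q)%:R) (l q) / ((l q)`!)%:R : R)) *
   (\prod_(r < p)
          (let lam := (\sum_(q < p | (r <= q)%N) l q)%N in
           let lam' := (\sum_(q < p | (r < q)%N) l q)%N in
           let nu := (\sum_(q < p | (q <= r)%N) n' q)%N in
           poch (alpha' r + (n' r)%:R + 1) lam'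
           * poch (alpha' r + (beta + n0%:R) + nu%:R + lam'%:R + 1) (l r)
           / poch (alpha' r + 1) lam)).
pose L (l : {ffun 'I_p -> 'I_K}) := (\sum_(q < p) l q)%N.
pose U (x : nat) l := poch (- n0%:R) x / (x`!)%:R *
    (poch (alpha ord0 + n0%:R + 1) (L l) * poch (alpha ord0 + beta + n0%:R + (L l)%:R + 1) x /
       poch (alpha ord0 + 1) (x + L l)) *
    (poch (t + 1) (x + L l) / poch (t + beta + 2) (x + L l)).
transitivity (\sum_(u : 'I_K * {ffun 'I_p -> 'I_K} | (u.1 <= n0)%N && [forall j, (u.2 j <= n' j)%N])
   T u.2 * U u.1 u.2).
  apply: eq_bigr => -[x l] _ /=.
  pose c := ffun_cons (x, l).
  have sumE (P : pred 'I_p.+1) (Q : pred 'I_p) : (forall j, P (lift ord0 j) = Q j) ->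
     (\sum_(q < p.+1 | P q) c q = (if P ord0 then x : nat else 0%N) + \sum_(j < p | Q j) l j)%N.
    move=> PQ; rewrite big_ord_lift_cond ffun_cons0; congr (_ + _)%N.
    by apply: eq_big => [j|j _]; rewrite ?PQ ?ffun_cons_lift.
  rewrite -/c (sumE xpredT xpredT)//= -/(L l).
  have h1 : (\sum_(i < p) c (lift ord0 i) = L l)%N.
    by apply: eq_bigr => j _; rewrite ffun_cons_lift.
  have h2 : (\sum_(q < p.+1 | (0 < q)%N) c q = L l)%N by rewrite (sumE _ xpredT).
  have h3 : (\sum_(q < p.+1 | (q <= 0)%N) n q = n0)%N.
    by rewrite big_ord_lift_cond /= big_pred0 ?addn0.
  rewrite !big_ord_recl /= h1 h2 h3 {1 2 3 4}/c ffun_cons0 /= -/n0.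
  have -> : \prod_(i < p) (poch (- (n (lift ord0 i))%:R) (c (lift ord0 i)) / ((c (lift ord0 i))`!)%:R) =
    \prod_(q < p) (poch (- (n' q)%:R) (l q) / ((l q)`!)%:R : R).
    by apply: eq_bigr => q _; rewrite /c ffun_cons_lift.
  rewrite /T /U; set A := \prod_(q < p) _; set D := (X in _ = _ * X * _).
  rewrite (eq_bigr (fun r : 'I_p =>
          (let lam := (\sum_(q < p | (r <= q)%N) l q)%N in
           let lam' := (\sum_(q < p | (r < q)%N) l q)%N in
           let nu := (\sum_(q < p | (q <= r)%N) n' q)%N in
           poch (alpha' r + (n' r)%:R + 1) lam'
           * poch (alpha' r + (beta + n0%:R) + nu%:R + lam'%:R + 1) (l r)
           / poch (alpha' r + 1) lam))); last first.
    move=> r _ /=.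
    rewrite (sumE _ (fun j : 'I_p => r < j)%N) ?ltn0 ?add0n; last by move=> j; rewrite /= /bump /= ?add1n ltnS.
    rewrite (sumE _ (fun j : 'I_p => r <= j)%N); last by move=> j; rewrite /= /bump /= ?add1n ltnS.
    have -> : (\sum_(q < p.+1 | (q <= bump 0 r)%N) n q = n0 + \sum_(j < p | (j <= r)%N) n' j)%N.
      by rewrite big_ord_lift_cond /=; congr (_ + _)%N; apply: eq_bigl => j.
    rewrite /= ffun_cons_lift /= natrD.
    by rewrite -/(alpha' r) -/(n' r) -[alpha' r + beta + _]addrA [beta + (_ + _)]addrA !addrA.
  rewrite -/D; ring.
rewrite -(pair_big (fun x : 'I_K => (x <= n0)%N) (fun l : {ffun 'I_p -> 'I_K} => [forall j, (l j <= n' j)%N])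
   (fun x l => T l * U x l)) /= exchange_big /=.
transitivity (\sum_(l : {ffun 'I_p -> 'I_K} | [forall j, (l j <= n' j)%N]) T l *
   (poch (t + 1) (L l) / poch (t + (beta + n0%:R) + 2) (L l)) *
   (poch (beta + 1) n0 / poch (t + beta + 2) n0 * (poch (alpha ord0 - t) n0 / poch (alpha ord0 + 1) n0))).
  apply: eq_bigr => l _; rewrite -mulr_sumr -mulrA; congr (_ * _).
  rewrite [RHS]mulrC -saalschutz_peel// big_mkord (big_ord_widen_cond K xpredT (fun x => U x l)) ?nK//.
have bn : -1 < beta + n0%:R by rewrite ltr_wpDr.
have := IH alpha' n' (beta + n0%:R) (fun q => nK (lift ord0 q)) (fun q => a1 (lift ord0 q)) bn t0.
rewrite -/T => IH'.
rewrite -mulr_suml IH' !big_ord_recl -/n0.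
have -> : (\sum_(i < p) n (lift ord0 i) = \sum_(i < p) n' i)%N by [].
set M := (\sum_(i < p) n' i)%N.
rewrite !pochD.
have -> : beta + 1 + n0%:R = beta + n0%:R + 1 by ring.
have -> : t + beta + 2 + n0%:R = t + (beta + n0%:R) + 2 by ring.
rewrite !invfM; ring.
Qed.
End MultiSum.

(** * Mellin transforms and type II polynomials *)

Section Mellin.
Variable R : realType.
Implicit Types (f g : {poly R}) (beta t : R).

(** The integral of x^t (1 - x)^beta f over [0, 1] divided by that of
    x^t (1 - x)^beta, as computed from the Beta function. *)
Definition mellin beta t f : R :=
  \sum_(k < size f) f`_k * (poch (t + 1) k / poch (t + beta + 2) k).

Lemma mellin_widen beta t f n : (size f <= n)%N ->
  mellin beta t f = \sum_(k < n) f`_k * (poch (t + 1) k / poch (t + beta + 2) k).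
Proof.
move=> fn; rewrite /mellin.
rewrite (big_ord_widen n (fun k => f`_k * (poch (t + 1) k / poch (t + beta + 2) k)) fn).
rewrite [RHS](bigID (fun k : 'I_n => (k < size f)%N)) /= [X in _ = _ + X]big1 ?addr0// => k.
by rewrite -leqNgt => fk; rewrite nth_default// mul0r.
Qed.

Lemma mellinD beta t f g : mellin beta t (f + g) = mellin beta t f + mellin beta t g.
Proof.
set n := maxn (size f) (size g).
rewrite (@mellin_widen _ _ _ n) ?(leq_trans (size_polyD _ _))//.
rewrite (@mellin_widen _ _ f n) ?leq_maxl// (@mellin_widen _ _ g n) ?leq_maxr//.
by rewrite -big_split/=; apply: eq_bigr => k _; rewrite coefD mulrDl.
Qed.

Lemma mellinZ beta t c f : mellin beta t (c *: f) = c * mellin beta t f.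
Proof.
rewrite (@mellin_widen _ _ _ (size f)) ?size_scale_leq// /mellin mulr_sumr.
by apply: eq_bigr => k _; rewrite coefZ mulrA.
Qed.

Lemma mellin0 beta t : mellin beta t 0 = 0.
Proof. by rewrite /mellin size_poly0 big_ord0. Qed.

Lemma mellin_sum beta t (I : Type) (s : seq I) (P : pred I) (F : I -> {poly R}) :
  mellin beta t (\sum_(i <- s | P i) F i) = \sum_(i <- s | P i) mellin beta t (F i).
Proof.
apply: (big_morph (mellin beta t)); [exact: mellinD|exact: mellin0].
Qed.

Lemma mellinXn beta t n : mellin beta t 'X^n = poch (t + 1) n / poch (t + beta + 2) n.
Proof.
rewrite /mellin size_polyXn big_ord_recr /= coefXn eqxx mul1r big1 ?add0r// => k _.
by rewrite coefXn ltn_eqF// mul0r.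
Qed.

Lemma mellinXM beta t f :
  mellin beta t ('X * f) = (t + 1) / (t + beta + 2) * mellin beta (t + 1) f.
Proof.
have sX : (size ('X * f)%R <= (size f).+1)%N.
  by rewrite (leq_trans (size_polyMleq _ _))// size_polyX.
rewrite (mellin_widen _ _ sX) big_ord_recl coefXM eqxx mul0r add0r /mellin mulr_sumr.
apply: eq_bigr => k _; rewrite coefXM /= !pochS.
have -> : t + beta + 2 + 1 = t + 1 + beta + 2 by ring.
by rewrite invfM; ring.
Qed.

Lemma poly_eq0_ge (f : {poly R}) (t0 : R) : (forall t, t0 <= t -> f.[t] = 0) -> f = 0.
Proof.
move=> f0; apply/eqP; apply: contraT => nz.
pose rs := [seq t0 + k%:R | k <- iota 0 (size f)].
have rts : all (root f) rs.
  by apply/allP => _ /mapP[k _ ->]; rewrite rootE f0// lerDl.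
have urs : uniq rs.
  rewrite map_inj_uniq ?iota_uniq// => i j /addrI /eqP.
  by rewrite eqr_nat => /eqP.
by have := max_poly_roots nz rts urs; rewrite size_map size_iota ltnn.
Qed.

(** Over the common denominator the Mellin transform is a polynomial in t, whose
    value at t = - (beta + 1 + d), d being the degree of f, is a nonzero multiple of
    the leading coefficient. *)
Lemma mellin_inj beta (t0 : R) f : -1 < beta -> 0 <= t0 ->
  (forall t, t0 <= t -> mellin beta t f = 0) -> f = 0.
Proof.
move=> b1 t00 mf; apply/eqP; apply: contraT => nz.
set d := (size f).-1.
have sf : size f = d.+1 by rewrite /d prednK// lt0n size_poly_eq0.
pose Pc (c : R) n : {poly R} := \prod_(0 <= i < n) ('X + (c + i%:R)%:P).
have PcE c n t : (Pc c n).[t] = poch (t + c) n.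
  rewrite horner_prod pochE; apply: eq_bigr => i _.
  by rewrite hornerD hornerX hornerC addrA.
pose G := \sum_(k < d.+1) f`_k *: (Pc 1 k * Pc (beta + 2 + k%:R) (d - k)%N).
have GE t : G.[t] = \sum_(k < d.+1) f`_k * (poch (t + 1) k * poch (t + beta + 2 + k%:R) (d - k)).
  rewrite horner_sum; apply: eq_bigr => k _; rewrite hornerZ hornerM !PcE.
  by rewrite !addrA.
have G0 : G = 0.
  apply: (@poly_eq0_ge _ t0) => t tt0; rewrite GE.
  have p0 n : poch (t + beta + 2) n != 0 by rewrite gt_eqF// poch_gt0//; lra.
  transitivity (poch (t + beta + 2) d * mellin beta t f); last by rewrite mf// mulr0.
  rewrite /mellin sf mulr_sumr; apply: eq_bigr => k _.
  have kd : (k <= d)%N by rewrite -ltnS.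
  have -> : poch (t + beta + 2) d = poch (t + beta + 2) k * poch (t + beta + 2 + k%:R) (d - k).
    by rewrite -pochD subnKC.
  by field.
have := GE (- (beta + 1 + d%:R)); rewrite G0 horner0 big_ord_recr /= subnn poch0 mulr1.
rewrite big1 ?add0r => [/esym/eqP|k _]; last first.
  have kd := ltn_ord k.
  have -> : (d - k = (d - k).-1.+1)%N by lia.
  rewrite [X in _ * (_ * X)]pochSr.
  have -> : - (beta + 1 + d%:R) + beta + 2 + k%:R + (d - k).-1%:R = 0.
    have -> : d%:R = k%:R + (d - k).-1%:R + 1 :> R by rewrite -natrD natr1; congr (_%:R); lia.
    by ring.
  by rewrite !mulr0.
rewrite mulf_eq0 => /orP[|].
  by rewrite /d -lead_coefE lead_coef_eq0 (negbTE nz).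
rewrite -[_ == 0]negbK poch_neq0// => i id.
have -> : - (beta + 1 + d%:R) + 1 + i%:R = - (beta + (d - i)%:R) by rewrite natrB 1?ltnW//; ring.
rewrite oppr_eq0 gt_eqF//.
have : (1 : R) <= (d - i)%:R by rewrite ler1n; lia.
by lra.
Qed.

End Mellin.

Section TypeIIRecurrence.
Variables (R : realType) (p : nat).
Hypothesis p_gt0 : (0 < p)%N.
Variables (alpha : 'rV[R]_p) (beta : R).
Hypothesis alpha_gt : forall i : 'I_p, -1 < alpha 0 i.
Hypothesis beta_gt : -1 < beta.
Hypothesis alphaB : forall i j : 'I_p, i != j -> alpha 0 i - alpha 0 j \isn't a Num.int.

Lemma mellin_JP2 (n : 'I_p -> nat) (t : R) : 0 <= t ->
  mellin beta t (JP2 alpha beta n) =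
  poch (beta + 1) (mnorm n) / poch (t + beta + 2) (mnorm n) *
  \prod_(q < p) ((-1) ^+ n q * poch (alpha 0 q - t) (n q) /
     poch (alpha 0 q + beta + (mnorm n)%:R + 1) (n q)).
Proof.
move=> t0; rewrite /JP2 mellin_sum.
pose C := (-1) ^+ mnorm n * \prod_(q < p) (poch (alpha 0 q + 1) (n q)
           / poch (alpha 0 q + beta + (mnorm n)%:R + 1) (n q)) : R.
have := @multi_saalschutz R p (mnorm n).+1 (fun q => alpha 0 q) n beta t.
move=> /(_ _ alpha_gt beta_gt t0) /(congr1 (fun x => C * x)) h.
transitivity (C * (poch (beta + 1) (mnorm n) / poch (t + beta + 2) (mnorm n) *
  \prod_(q < p) (poch (alpha 0 q - t) (n q) / poch (alpha 0 q + 1) (n q)))).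
  rewrite -h; last by move=> q; rewrite ltnS /mnorm (bigD1 q)//= leq_addr.
  rewrite mulr_sumr; apply: eq_bigr => l _.
  rewrite mellinZ mellinXn big_split /= /C.
  by rewrite !mulrA.
rewrite mulrCA; congr (_ * _).
rewrite /C /mnorm -prodrXr -!big_split/=; apply: eq_bigr => q _.
have q0 : poch (alpha 0 q + 1) (n q) != 0.
  by rewrite gt_eqF// poch_gt0//; have := alpha_gt q; move: (alpha 0 q) => x; lra.
rewrite -/(mnorm n); move: (poch (alpha 0 q + beta + _ + 1) _)^-1 => u.
by field.
Qed.

Lemma mellin_stepB N (t : R) : 0 <= t ->
  mellin beta t (stepB alpha beta N) =
  mellin_norm (node alpha) beta N * \prod_(0 <= r < N) (t - node alpha r) / poch (t + beta + 2) N.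
Proof.
move=> t0; rewrite /stepB mellin_JP2// mnorm_stepline// big_split/=.
have -> : \prod_(q < p) ((-1) ^+ stepline N q * poch (alpha 0 q - t) (stepline N q)) =
  \prod_(0 <= r < N) (t - node alpha r).
  rewrite -(big_stepline p_gt0); apply: eq_bigr => q _.
  have -> : alpha 0 q - t = - (t - alpha 0 q) by ring.
  rewrite -prod_falling_poch; apply: eq_bigr => s _.
  by rewrite nodeDM// node_ord; ring.
rewrite prodfV /mellin_norm.
have -> : shiftprod (node alpha) (beta + N.+1%:R) N =
  \prod_(q < p) poch (alpha 0 q + beta + N%:R + 1) (stepline N q).
  rewrite /shiftprod -(big_stepline p_gt0); apply: eq_bigr => q _.
  rewrite pochE; apply: eq_bigr => s _.
  by rewrite nodeDM// node_ord -natr1; ring.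
by ring.
Qed.

(** Both sides have the same Mellin transform for large t, by type2_rec at t + 1. *)
Lemma stepB_rec n :
  'X * stepB alpha beta n = stepB alpha beta n.+1 + b_coef alpha beta 0 n *: stepB alpha beta n +
    \sum_(1 <= j < p.+1) b_coef alpha beta j n *:
       (if (j <= n)%N then stepB alpha beta (n - j)%N else 0).
Proof.
set a := node alpha.
have aS r : a (r + p)%N = a r + 1 by exact: nodeS.
have a_gt : forall r, -1 < a r := node_gtN1 p_gt0 alpha_gt.
have a_inj : injective a := node_inj p_gt0 alphaB.
(* For t >= t0 the factors t + 1 - a r with r < p are positive. *)
pose t0 := \sum_(0 <= r < p) `|a r|.
have t00 : 0 <= t0 by apply: sumr_ge0.
apply/eqP; rewrite -subr_eq0; apply/eqP; apply: (@mellin_inj _ beta t0) => // t tt0.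
have t_ge0 : 0 <= t by exact: le_trans tt0.
rewrite -scaleN1r !(mellinD, mellinZ) mellinXM mulN1r; apply/eqP; rewrite subr_eq0; apply/eqP.
rewrite -[RHS]addrA.
have -> : b_coef alpha beta 0 n * mellin beta t (stepB alpha beta n) +
  mellin beta t (\sum_(1 <= j < p.+1) b_coef alpha beta j n *:
       (if (j <= n)%N then stepB alpha beta (n - j)%N else 0)) =
  \sum_(0 <= j < p.+1 | (j <= n)%N) rcoef p a beta (n - j) j * mellin beta t (stepB alpha beta (n - j)).
  rewrite [RHS]big_mkcond big_ltn// leq0n subn0 b_coefE// subn0; congr (_ + _).
  rewrite mellin_sum; apply: eq_big_nat => j /andP[_ jp].
  by rewrite mellinZ b_coefE//; case: ifP => // _; rewrite mul0r.
have Q0 : \prod_(0 <= r < p) (t + 1 - a r) != 0.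
  apply: prod_nat_neq0 => r rp _; rewrite gt_eqF//.
  have ra : `|a r| <= t0.
    rewrite /t0 (bigD1_seq r)/= ?mem_index_iota ?iota_uniq//.
    by rewrite lerDl sumr_ge0.
  by have := ler_norm (a r); lra.
have split N : \prod_(0 <= r < p + N) (t + 1 - a r) =
   \prod_(0 <= r < p) (t + 1 - a r) * \prod_(0 <= r < N) (t - a r).
  rewrite (big_cat_nat (n := p)) ?leq_addr//=; congr (_ * _).
  by rewrite big_nat_shift0; apply: eq_bigr => r _; rewrite addnC aS; ring.
have p0 (x : R) m : 0 < x -> poch x m != 0 by move=> x0; rewrite gt_eqF// poch_gt0.
have tb : 0 < t + beta + 2 by move: beta_gt; lra.
(* Multiplication by F turns type2_rec into the identity of Mellin transforms. *)
pose F := \prod_(0 <= r < n) (t + 1 - a r) /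
   (\prod_(0 <= r < p) (t + 1 - a r) * poch (t + beta + 2) n.+1).
have := @type2_rec R p a p_gt0 aS a_inj a_gt beta n (t + 1) beta_gt.
move=> /(congr1 (fun x => F * x)).
rewrite mulrDr mulr_sumr => h.
transitivity (F * (mellin_norm a beta n * (nodepoly p a).[t + 1])).
  rewrite mellin_stepB ?addr_ge0// horner_nodepoly /F pochS.
  have -> : t + beta + 2 + 1 = t + 1 + beta + 2 by ring.
  have q1 : poch (t + 1 + beta + 2) n != 0 by rewrite p0//; lra.
  by field; rewrite q1 Q0 gt_eqF.
rewrite h; congr (_ + _).
  rewrite mellin_stepB// /F /segpoly.
  have -> : \prod_(0 <= r < n.+1) (t - node alpha r) =
     \prod_(0 <= r < n) (t + 1 - a r) * \prod_(n <= r < n + p.+1) (t + 1 - a r) /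
     \prod_(0 <= r < p) (t + 1 - a r).
    rewrite -big_cat_nat ?leq_addr//=.
    have -> : (n + p.+1 = p + n.+1)%N by lia.
    by rewrite split mulrC mulKf.
  have q1 := p0 _ n.+1 tb.
  by field; rewrite q1 Q0.
rewrite big_nat_cond [RHS]big_nat_cond; apply: eq_bigr => j /andP[/andP[_ jp] jn].
rewrite mellin_stepB// /F.
have -> : \prod_(0 <= r < n - j) (t - node alpha r) =
   \prod_(0 <= r < n) (t + 1 - a r) * \prod_(n <= r < n - j + p) (t + 1 - a r) /
   \prod_(0 <= r < p) (t + 1 - a r).
  rewrite -big_cat_nat//=; last by lia.
  by rewrite addnC split mulrC mulKf.
have -> : poch (t + beta + 2) n.+1 = poch (t + beta + 2) (n - j) * poch (t + 1 + beta + (n - j).+1%:R) j.+1.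
  have {1}-> : (n.+1 = (n - j) + j.+1)%N by lia.
  by rewrite pochD; congr (_ * poch _ _); rewrite -natr1; ring.
have q1 := p0 _ (n - j)%N tb.
have q2 : poch (t + 1 + beta + (n - j).+1%:R) j.+1 != 0.
  by rewrite p0//; have := ler0n R (n - j); rewrite -natr1; lra.
by field; rewrite q1 q2 Q0.
Qed.

End TypeIIRecurrence.

(** * The recurrences *)

Theorem corollary2p2 (R : realType) (p : nat) (alpha : 'rV[R]_p) (beta : R)
    (p_gt0 : (0 < p)%N)
    (alpha_gt : forall i : 'I_p, -1 < alpha 0 i)
    (beta_gt : -1 < beta)
    (alphaB : forall i j : 'I_p, i != j -> alpha 0 i - alpha 0 j \isn't a Num.int) :
  let B := stepB alpha beta in
  let A := stepA alpha beta in
  let b := b_coef alpha beta in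
  [/\ (* the continuous extensions that define the coefficients exist *)
      forall j m k : nat, (j <= p)%N -> (k < p)%N ->
        cvg (@b_formula R p j m k @ b_nbhs j m k (alpha, beta)),
      forall n : nat,
        'X * B n = B n.+1 + b 0%N n *: B n
          + \sum_(1 <= j < p.+1)
              b j n *: (if (j <= n)%N then B (n - j)%N else 0)
    & forall (n : nat) (i : 'I_p), (1 <= n)%N ->
        'X * A i n = A i n.-1 + b 0%N n.-1 *: A i n
          + \sum_(1 <= j < p.+1) b j (n + j).-1 *: A i (n + j)%N].
Proof.
move=> B A b; split.
- move=> j m k jp kp; apply/cvg_ex; exists (bcoef_limit alpha beta j m k).
  exact: cvg_b_formula.
- by move=> n; exact: stepB_rec.
- by move=> n i n1; exact: stepA_rec.
Qed.
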